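(* Let $\{(X_n,Y_n)\}_{n\ge 0}$ be a randomly reinforced urn (as defined in the context) with initial composition $(x,y)$, where $x,y$ are non-negative real numbers with $x+y>0$, and reinforcement distributions $\mu,\nu$ on $[0,\beta]$. If $m_\mu=m_\nu=m>0$, then the distribution of $Z_\infty$ has no point masses, i.e. $P(Z_\infty=p)=0$ for all $p\in[0,1]$.
   Context: Randomly reinforced urn (RRU). On a probability space $(\Omega,\mathcal A,P)$ let $\{U_n\}_{n\ge1}$ be i.i.d. uniform on $[0,1]$, and let $\{(V_n,W_n)\}_{n\ge1}$ be i.i.d. bivariate random vectors, each of whose components is uniform on $[0,1]$ ($V_n$ and $W_n$ may be dependent on each other); the sequences $\{U_n\}$ and $\{(V_n,W_n)\}$ are independent. Let $\beta>0$ and let $\mu,\nu$ be probability distributions on $[0,\beta]$ with means $m_\mu,m_\nu$ and quantile functions $q_\mu,q_\nu$. Set $R_X(n)=q_\mu(V_n)$ and $R_Y(n)=q_\nu(W_n)$, so $R_X(n)\sim\mu$ and $R_Y(n)\sim\nu$. Let $x,y\ge0$ be real numbers with $x+y>0$. Set $X_0=x$, $Y_0=y$ and, for $n\ge0$, $$X_{n+1}=X_n+R_X(n+1)\delta_{n+1},\qquad Y_{n+1}=Y_n+R_Y(n+1)(1-\delta_{n+1}),$$ where $\delta_{n+1}$ is the indicator of the event $\{U_{n+1}\le X_n/(X_n+Y_n)\}$. Let $Z_n=X_n/(X_n+Y_n)$. It is known that $Z_n$ converges almost surely to a random variable $Z_\infty\in[0,1]$.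
   Formalization: The initial composition is required to satisfy x > 0 and y > 0; if x = 0 or y = 0 the claim is false, since then Z_n is almost surely constantly 0 or 1, so Z_∞ has a point mass there. *)

(* Defs.v *)
From HB Require Import structures.
From mathcomp Require Import all_boot all_order all_algebra finmap.
From mathcomp Require Import all_classical all_reals all_analysis.

Set Implicit Arguments.
Unset Strict Implicit.
Unset Printing Implicit Defensive.

Import Order.TTheory GRing.Theory Num.Theory.
Import numFieldNormedType.Exports.

Local Open Scope classical_set_scope.
Local Open Scope ring_scope.

Section independence.
Context {d d'} {T : measurableType d} {T' : measurableType d'} {R : realType} (P : probability T R).

Definition mutually_independent (X : nat -> {RV P >-> T'}) : Prop :=
  forall (J : {fset nat}) (B : nat -> set T'),
    (forall i, i \in J -> measurable (B i)) ->
    P (\bigcap_(i in [set` J]) (X i @^-1` B i)) =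
    (\prod_(i <- J) P (X i @^-1` B i))%E.

Definition identically_distributed (X : nat -> {RV P >-> T'}) : Prop :=
  forall i j (B : set T'), measurable B ->
    distribution P (X i) B = distribution P (X j) B.

Definition iid (X : nat -> {RV P >-> T'}) : Prop :=
  mutually_independent X /\ identically_distributed X.

Definition sigma_seq (X : nat -> {RV P >-> T'}) : set (set T) :=
  <<s \bigcup_n g_sigma_algebra_preimage (X n) >>.

End independence.

Definition independent_seq {d d1 d2} {T : measurableType d}
    {T1 : measurableType d1} {T2 : measurableType d2} {R : realType}
    (P : probability T R) (X : nat -> {RV P >-> T1})
    (Y : nat -> {RV P >-> T2}) : Prop :=
  forall A B, sigma_seq X A -> sigma_seq Y B ->
    P (A `&` B) = (P A * P B)%E.

Section urn.
Context {R : realType}.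

Definition is_uniform01 {d} {T : measurableType d} (P : probability T R)
    (X : T -> R) : Prop :=
  forall B : set R, measurable B ->
    P (X @^-1` B) = uniform_prob (@ltr01 R) B.

Definition mean (mu : probability (measurableTypeR R) R) : \bar R :=
  (\int[mu]_r r%:E)%E.

(* The infimum is the usual one for 0 < v <= 1 when mu is supported by a
   bounded interval. For v outside ]0, 1] the set has no infimum and the
   value is the default 0; this only matters on a null event. *)
Definition quantile (mu : probability (measurableTypeR R) R) (v : R) : R :=
  inf [set r : R | (v%:E <= mu `]-oo, r]%classic)%E].

(* Pathwise recursion for (X_n, Y_n). The driving sequences are indexed from 0:
   u n, rX n, rY n are U_{n+1}, R_X(n+1), R_Y(n+1).
   If x = 0 or y = 0, the missing color almost surely never enters the urn and
   X_n / (X_n + Y_n) is almost surely constant in n, equal to 0 or 1. *)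
Fixpoint urn (x y : R) (u rX rY : nat -> R) (n : nat) : R * R :=
  if n is k.+1 then
    let: (X, Y) := urn x y u rX rY k in
    let delta : R := (u k <= X / (X + Y))%R%:R in
    (X + rX k * delta, Y + rY k * (1 - delta))
  else (x, y).

Section rru.
Context {d} {T : measurableType d} (P : probability T R).
Variables (U : nat -> {RV P >-> R}) (VW : nat -> {RV P >-> (R * R)%type}).

(* VW n is the vector (V_{n+1}, W_{n+1}), U n is U_{n+1}. *)
Record rru_driving : Prop := RRUDriving {
  U_iid : iid U ;
  U_uniform : forall n, is_uniform01 P (U n) ;
  VW_iid : iid VW ;
  V_uniform : forall n, is_uniform01 P (fun w => (VW n w).1) ;
  W_uniform : forall n, is_uniform01 P (fun w => (VW n w).2) ;
  U_VW_independent : independent_seq U VW }.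

Variables (mu nu : probability (measurableTypeR R) R) (x y : R).

Definition rru (n : nat) (w : T) : R * R :=
  urn x y (fun k => U k w)
    (fun k => quantile mu (VW k w).1) (fun k => quantile nu (VW k w).2) n.

Definition rru_proportion (n : nat) (w : T) : R :=
  (rru n w).1 / ((rru n w).1 + (rru n w).2).

End rru.
End urn.

(* Main.v *)
From HB Require Import structures.
Require Import Defs.
From mathcomp Require Import all_boot all_order all_algebra finmap.
From mathcomp Require Import all_classical all_reals all_analysis.
From mathcomp Require Import measurable_realfun ring lra.
Import Order.TTheory GRing.Theory Num.Theory.
Import numFieldNormedType.Exports.
Local Open Scope classical_set_scope.
Local Open Scope ring_scope.
Set Implicit Arguments.
Unset Strict Implicit.

(** With [S] the total, [z] the proportion of the first color and [t = r/(S+r)],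
    a draw moves [z] by [(1-z)t] or [-zt] and turns [1/S] into [(1-t)/S]. The
    process [1/S] is thus an intrinsic clock for the conditional variance of
    [z], and no law of large numbers for [S] is needed.

    For [0 < p < 1], put [D = z - p]. Once [1/S] is small,
    [D^2 + c/S - K D^2/S] is a submartingale (the last term absorbs the
    drift of [z], which is only [O(1/S^2)] because the means agree) and
    [D^4 + a D^2/S + e/S^2] is a supermartingale. Given the past, the limit
    therefore has [E D^2] at least, and [E D^4] at most, of the orders of
    [u = D_n^2 + 1/S_n] and [u^2], and Paley-Zygmund gives that the limit differs
    from [p] with conditional probability at least some [eta > 0], uniformly in
    the past. Applied on the event that [Z_n] is near [p], which for large
    [n] is nearly the event that the limit is [p], this forces the latter to be
    null.

    At [p = 0] the potential [ln(S/X) + beta/X] is a nonnegative supermartingale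
    that blows up as [z] tends to 0; [p = 1] follows by exchanging the colors. *)

(** * Quantile transform *)

(** No conditional expectation is formed. Conditioning on the state at time [n] becomes
    multiplication by a nonnegative weight [h (state n)] under the integral. Since the total never
    decreases, a weight supported where [inv_total] is small keeps all later states in the region
    where the drift inequalities hold.

    Apart from support and mean, [mu] and [nu] are arbitrary. Each one-step estimate is therefore
    reduced to an affine bound in the reinforcement [r], one for each color, whose average needs
    only [m]. The terms of order [D/S] have opposite signs for the two colors and cancel exactly,
    because the means agree.

    Paley-Zygmund is made scale-free by the weights [1/u] and [1/u^2]: both moment bounds become
    multiples of the integral of one cutoff [g], and the inequality [(1 - 2 eps q)^2 >= 0] with
    [q = (Zinf - p)^2 / u] takes the place of Cauchy-Schwarz. The cutoffs are tents rather than
    indicators, so that they pass to the almost sure limit even if [Zinf] charges the endpoints of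
    the interval. *)

Lemma lebesgue_measure_itv0 {R : realType} (z : R) : 0 <= z ->
  lebesgue_measure `[0, z]%classic = z%:E.
Proof.
move=> z0; rewrite lebesgue_measure_itv/= lte_fin oppr0 adde0.
by case: ltP => // z0'; congr EFin; apply/eqP; rewrite eq_le z0.
Qed.

Lemma uniform01_preimage {R : realType} d (T : measurableType d)
    (P : probability T R) (V : T -> R) (V01 : is_uniform01 P V) (B : set R) :
  measurable B -> P (V @^-1` B) = lebesgue_measure (B `&` `[0, 1]%classic).
Proof.
move=> mB; rewrite V01// /uniform_prob integral_uniform_pdf.
rewrite (eq_integral (cst 1%E)).
  by rewrite integral_cst ?mul1e//; exact: measurableI.
move=> z; rewrite inE => -[_] /=; rewrite in_itv/= /uniform_pdf => ->.
by rewrite subr0 invr1.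
Qed.

Lemma uniform01_le {R : realType} d (T : measurableType d)
    (P : probability T R) (V : T -> R) (V01 : is_uniform01 P V) (z : R) :
  0 <= z <= 1 -> P [set w | V w <= z] = z%:E.
Proof.
move=> /andP[z0 z1].
rewrite (_ : [set w | V w <= z] = V @^-1` `]-oo, z]%classic); last first.
  by rewrite preimage_itvNyc.
rewrite (uniform01_preimage V01)// -[RHS]lebesgue_measure_itv0//.
congr (lebesgue_measure _); apply/seteqP; split => r /=; rewrite !in_itv/=.
  by move=> [-> /andP[->]].
by move=> /andP[-> rz]; rewrite rz (le_trans rz).
Qed.

Section quantile.
Context {R : realType} (mu : probability (measurableTypeR R) R) (beta : R).
Hypothesis hbeta : 0 < beta.
Hypothesis hmu : mu `[0, beta]%classic = 1%E.

Let F (r : R) : \bar R := mu `]-oo, r]%classic.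

Let F_mono r s : r <= s -> (F r <= F s)%E.
Proof. by move=> rs; rewrite /F le_measure ?inE//; exact: subitvPr. Qed.

Let F_lt0 r : r < 0 -> F r = 0%E.
Proof.
move=> r0; apply/eqP; rewrite eq_le measure_ge0 andbT.
have <- : mu (~` `[0, beta]%classic) = 0%E.
  by rewrite probability_setC// hmu subee.
rewrite /F le_measure ?inE//; first exact: measurableC.
move=> z /=; rewrite !in_itv/= => zr; apply/negP.
by rewrite negb_and -ltNge (le_lt_trans zr r0).
Qed.

Let F_beta : F beta = 1%E.
Proof.
apply/eqP; rewrite eq_le probability_le1//= -hmu le_measure ?inE//.
exact: subitvPl.
Qed.

(** Right continuity of the distribution function, in the form that puts the infimum defining
    [quantile] into its own set. *)
Let F_right_cts (a : R) (v : \bar R) :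
  (forall r, a < r -> (v <= F r)%E) -> (v <= F a)%E.
Proof.
move=> h; rewrite /F (itvNycEbigcap false).
have : (mu \o (fun k => `]-oo, (a + k.+1%:R^-1)%R]%classic)) n @[n --> \oo]
    --> mu (\bigcap_k `]-oo, (a + k.+1%:R^-1)%R]%classic).
  apply: nonincreasing_cvg_mu => //.
  - by rewrite (le_lt_trans (probability_le1 _ _))// ltry.
  - exact: bigcapT_measurable.
  - move=> i j ij; apply/subsetPset; apply: subitvPr.
    by rewrite leBSide/= lerD2l lef_pV2 ?posrE// ler_nat.
move=> /cvg_lim <-//; apply: lime_ge.
  apply: ereal_nonincreasing_is_cvgn => i j ij /=.
  by rewrite -!/(F _) F_mono// lerD2l lef_pV2 ?posrE// ler_nat.
by apply: nearW => k /=; apply: h; rewrite ltrDl.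
Qed.

(** The Galois connection between quantile and distribution function. As the infimum is attained,
    the equivalence holds at every [r], atoms and flat stretches of [F] included. *)
Lemma quantile_le v r : 0 < v <= 1 ->
  (quantile mu v <= r) = (v%:E <= mu `]-oo, r]%classic)%E.
Proof.
move=> /andP[v0 v1]; set S := [set r : R | (v%:E <= F r)%E].
have Sbeta : S beta by rewrite /S /= F_beta lee_fin.
have lbS : lbound S 0.
  move=> s; rewrite /S /= => Ss; rewrite leNgt; apply/negP => s0.
  by move: Ss; rewrite F_lt0// lee_fin leNgt v0.
have infS : has_inf S by split; [exists beta|exists 0].
apply/idP/idP => [qr|vr]; last by apply: ge_inf => //; exists 0.
suff vq : (v%:E <= F (quantile mu v))%E by exact: (le_trans vq (F_mono qr)).
apply: F_right_cts => s qs.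
have [t St ts] := inf_lt (ex_intro _ _ Sbeta) qs.
by apply: (le_trans St); apply: (F_mono (ltW ts)).
Qed.

(** For [v <= 0] the set is the whole line, for [v > 1] it is empty; in both cases [inf] takes its
    default value. *)
Lemma quantile_eq0 v : ~~ (0 < v <= 1) -> quantile mu v = 0.
Proof.
rewrite negb_and -leNgt -ltNge => /orP[v0|v1]; apply: inf_out => -[].
- move=> _ [m /(_ (m - 1))/=] h; have : m <= m - 1; last by lra.
  by apply: h; rewrite (le_trans _ (measure_ge0 _ _))// lee_fin.
- move=> [r /= vr] _.
  have := le_trans vr (probability_le1 mu (measurable_itv _)).
  by rewrite lee_fin leNgt v1.
Qed.

Lemma quantile_ge0 v : 0 <= quantile mu v.
Proof.
have [v01|/quantile_eq0->//] := boolP (0 < v <= 1).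
rewrite leNgt; apply/negP => q0.
have := quantile_le (quantile mu v) v01; rewrite lexx => /esym.
by rewrite -/(F _) F_lt0// lee_fin leNgt; case/andP: v01 => ->.
Qed.

Lemma quantile_le_bound v : quantile mu v <= beta.
Proof.
have [v01|/quantile_eq0->] := boolP (0 < v <= 1); last exact: ltW.
by rewrite quantile_le// -/(F _) F_beta lee_fin; case/andP: v01.
Qed.

Lemma quantile_mono v w : 0 < v -> v <= w -> w <= 1 ->
  quantile mu v <= quantile mu w.
Proof.
move=> v0 vw w1; rewrite quantile_le ?v0 ?(le_trans vw)//.
rewrite (@le_trans _ _ w%:E)// ?lee_fin// -quantile_le//.
by rewrite (lt_le_trans v0).
Qed.

Lemma measurable_quantile : measurable_fun [set: R] (quantile mu).
Proof.
(* The default 0 beyond 1 spoils monotonicity. With the value [beta] there, [q] is monotone on the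
   whole line, and it agrees with [quantile mu] on []0, 1]]. *)
pose q v := if v <= 0 then 0 else if 1 < v then beta else quantile mu v.
have -> : quantile mu = fun v => if 0 < v <= 1 then q v else 0.
  apply/funext => v; case: ifPn => [v01|/quantile_eq0//].
  by case/andP: v01 => v0 v1; rewrite /q leNgt v0/= ltNge v1.
apply: measurable_fun_ifT => //.
  by apply: measurable_and => //; [exact: measurable_fun_ltr|
    exact: measurable_fun_ler].
apply: nondecreasing_measurable => // v w vw; rewrite /q.
case: (leP v 0) => v0; case: (leP w 0) => w0; case: (ltP 1 v) => v1;
  case: (ltP 1 w) => w1;
  rewrite ?(ltW hbeta) ?quantile_ge0 ?quantile_le_bound ?lexx//; try lra.
exact: quantile_mono.
Qed.

(** Both means are integrals of tails, and by [quantile_le] the values [v] in [[0, 1]] with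
    [quantile mu v <= r] form the interval [[0, F r]], so the tails agree. [Y] clips the identity at
    0 because the tail formula asks for nonnegativity everywhere, while [mu] grants it almost
    everywhere. *)
Lemma expectation_quantile d (T : measurableType d) (P : probability T R)
    (V : T -> R) (mV : measurable_fun [set: T] V) (V01 : is_uniform01 P V) :
  (\int[P]_w (quantile mu (V w))%:E = mean mu)%E.
Proof.
have mq : measurable_fun [set: T] (quantile mu \o V).
  by apply: measurableT_comp => //; exact: measurable_quantile.
have mp : measurable_fun [set: measurableTypeR R] (fun r : measurableTypeR R => Num.max 0 r).
  exact: (measurable_maxr (f := cst 0) (g := id)).
pose qV := isMeasurableFun.Build _ _ _ _ (quantile mu \o V) mq.
pose X : {RV P >-> R} := HB.pack (quantile mu \o V) qV.
pose Y : {RV mu >-> R} := HB.pack (fun r : measurableTypeR R => Num.max 0 r)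
  (isMeasurableFun.Build _ _ _ _ (fun r : measurableTypeR R => Num.max 0 r) mp).
have aemu : {ae mu, forall r : R, 0 <= r <= beta}.
  exists (~` `[0, beta]%classic); split.
  - exact: measurableC.
  - by rewrite probability_setC// hmu subee.
  - by move=> r /= /negP rb; rewrite in_itv/=; exact/negP.
have -> : mean mu = (\int[mu]_r (Y r)%:E)%E.
  rewrite /mean; apply: (@ae_eq_integral _ _ _ _ _ (fun r => (Y r)%:E)) => //.
  - exact: (measurableT_comp (@EFin_measurable R setT) mp).
  - case: aemu => N [mN muN subN]; exists N; split => //.
    apply: subset_trans subN => r /= nr r01; apply: nr => _.
    by rewrite max_r//; case/andP: r01.
rewrite (_ : \int[P]_w _ = \int[P]_w (X w)%:E)%E//.
rewrite -!expectation_def !ge0_expectation_ccdf//; last first.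
- by move=> w; exact: quantile_ge0.
- by move=> w; rewrite /Y/= le_max lexx.
apply: eq_integral => r; rewrite inE/= in_itv/= andbT => r0.
rewrite !ccdf_1_cdf; congr (1 - _)%E.
rewrite /cdf/= /distribution /pushforward/=.
have Ffin : F r \is a fin_num by rewrite fin_num_measure.
have -> : (fun r => Num.max 0 r : R) @^-1` `]-oo, r] = `]-oo, r]%classic.
  by apply/seteqP; split => z /=; rewrite !in_itv/= ge_max r0.
have mB : measurable (quantile mu @^-1` `]-oo, r]%classic).
  by rewrite -[X in measurable X]setTI; exact: measurable_quantile.
transitivity (P (V @^-1` (quantile mu @^-1` `]-oo, r]%classic))); first by [].
rewrite (uniform01_preimage V01)//.
have F01 : 0 <= fine (F r) <= 1.
  by rewrite fine_ge0//= -lee_fin fineK// probability_le1.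
have -> : quantile mu @^-1` `]-oo, r]%classic `&` `[0, 1]%classic
    = `[0, fine (F r)]%classic.
  apply/seteqP; split => v /=; rewrite !in_itv/=.
    move=> -[qr /andP[v0 v1]]; rewrite v0/=.
    move: v0; rewrite le_eqVlt => /predU1P[<-|v0]; first by case/andP: F01.
    by rewrite -lee_fin fineK// -quantile_le// v0.
  move=> /andP[v0 vF]; have v1 : v <= 1 by case/andP: F01 => _; exact: le_trans.
  rewrite v0 v1; split=> //; move: v0; rewrite le_eqVlt => /predU1P[<-|v0].
    (* At [v = 0] the default value 0 of [quantile] is at most [r], so the endpoint belongs to both
       sets. *)
    by rewrite quantile_eq0// ltxx.
  by rewrite quantile_le ?v0//= -lee_fin in vF *; rewrite fineK in vF.
by rewrite lebesgue_measure_itv0 ?fineK//; case/andP: F01.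
Qed.
End quantile.

(** * Independence and iterated integrals *)

Section independent_pair.
Context d {T : measurableType d} {R : realType} (P : probability T R).

(** Dynkin's argument: the finite measures [A |-> P (A]&[D)] and [A |-> P D * P A] agree on a
    pi-system containing the whole space, hence on the sigma-algebra that it generates. *)
Lemma independent_sigma_algebra (G : set (set T)) (D : set T) :
  G `<=` measurable -> setI_closed G -> G setT -> measurable D ->
  (forall A, G A -> P (A `&` D) = P A * P D)%E ->
  forall A, <<s G >> A -> (P (A `&` D) = P A * P D)%E.
Proof.
move=> Gm GI GT mD GD A sGA.
have PD : P D \is a fin_num by rewrite fin_num_measure.
have PD0 : 0 <= fine (P D) by rewrite fine_ge0.
have := @g_sigma_algebra_measure_unique _ _ _ G Gm (fun=> setT) (fun=> GT) _
  (mrestr P mD) (mscale (NngNum PD0) P) GI _ _ A sGA.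
rewrite /= /mrestr /mscale/= fineK// [X in _ -> _ = X]muleC; apply.
- by rewrite bigcup_const//; exists 0%N.
- by move=> B GB; rewrite GD// muleC.
- by move=> _; rewrite setTI ltey_eq PD.
Qed.

Context d1 d2 {T1 : measurableType d1} {T2 : measurableType d2}.
Variables (X : T -> T1) (Y : T -> T2).
Hypotheses (mX : measurable_fun setT X) (mY : measurable_fun setT Y).

Hypothesis indep : forall A B, measurable A -> measurable B ->
  (P (X @^-1` A `&` Y @^-1` B) = P (X @^-1` A) * P (Y @^-1` B))%E.

(** Independence identifies the joint law with the product of the two laws; Tonelli does the
    rest. *)
Lemma integral_independent_pair (f : T1 * T2 -> \bar R) :
  measurable_fun setT f -> (forall z, 0 <= f z)%E ->
  (\int[P]_w f (X w, Y w) = \int[P]_w \int[P]_w' f (X w, Y w'))%E.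
Proof.
move=> mf f0.
pose X' : {mfun T >-> T1} := HB.pack X (isMeasurableFun.Build _ _ _ _ X mX).
pose Y' : {mfun T >-> T2} := HB.pack Y (isMeasurableFun.Build _ _ _ _ Y mY).
have mZ : measurable_fun setT (fun w => (X w, Y w)) by exact: measurable_fun_pair.
pose Z : {mfun T >-> (T1 * T2)%type} := HB.pack (fun w => (X w, Y w))
  (isMeasurableFun.Build _ _ _ _ (fun w => (X w, Y w)) mZ).
transitivity (\int[distribution P Z]_z f z)%E.
  by rewrite ge0_integral_distribution.
transitivity (\int[distribution P X' \x distribution P Y']_z f z)%E.
  apply: eq_measure_integral => A mA _; apply/esym.
  by apply: product_measure_unique => //.
rewrite fubini_tonelli1//= ge0_integral_distribution//=; last 2 first.
- exact: measurable_fun_fubini_tonelli_F.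
- by move=> z; apply: integral_ge0.
apply: eq_integral => w _ /=.
rewrite /fubini_F ge0_integral_distribution//.
exact: measurableT_comp mf (pair1_measurable _).
Qed.

End independent_pair.

Section driving.
Context d {T : measurableType d} {R : realType} (P : probability T R).

Fixpoint initial_segment (n : nat) : {fset nat} :=
  if n is m.+1 then (m |` initial_segment m)%fset else fset0.

Lemma in_initial_segment n i : (i \in initial_segment n) = (i < n)%N.
Proof.
elim: n => [|n IHn]; first by rewrite in_fset0 ltn0.
by rewrite in_fset1U IHn ltnS [RHS]leq_eqVlt.
Qed.

Lemma big_initial_segment (F : nat -> \bar R) n :
  (\prod_(i <- initial_segment n) F i = \prod_(i < n) F i)%E.
Proof.
elim: n => [|n IHn]/=; first by rewrite big_seq_fset0 big_ord0.
rewrite big_fsetU1; last by rewrite in_initial_segment ltnn.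
by rewrite /= IHn big_ord_recr/= muleC.
Qed.

Definition cylinder {d'} {T' : measurableType d'} (X : nat -> {RV P >-> T'})
  (B : nat -> set T') n := \bigcap_(i in [set` initial_segment n]) (X i @^-1` B i).

Context d1 d2 {T1 : measurableType d1} {T2 : measurableType d2}.
Variables (U : nat -> {RV P >-> T1}) (V : nat -> {RV P >-> T2}).

Lemma cylinderS d' {T' : measurableType d'} (X : nat -> {RV P >-> T'})
  (B : nat -> set T') n :
  cylinder X B n.+1 = cylinder X B n `&` (X n @^-1` B n).
Proof.
by rewrite /cylinder /= set_fsetU1 bigcap_setU1 setIC.
Qed.

Lemma eq_cylinder d' {T' : measurableType d'} (X : nat -> {RV P >-> T'})
  (B C : nat -> set T') n : (forall i, (i < n)%N -> B i = C i) ->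
  cylinder X B n = cylinder X C n.
Proof.
move=> BC; apply: eq_bigcapr => i /=; rewrite in_initial_segment => /BC ->//.
Qed.

Lemma measurable_cylinder d' {T' : measurableType d'} (X : nat -> {RV P >-> T'})
  (B : nat -> set T') n : (forall i, measurable (B i)) ->
  measurable (cylinder X B n).
Proof.
move=> mB; apply: bigcap_measurableType => i _.
by rewrite -[X in measurable X]setTI; exact: measurable_funPT.
Qed.

Lemma sigma_seq_cylinder d' {T' : measurableType d'} (X : nat -> {RV P >-> T'})
  (B : nat -> set T') n : (forall i, measurable (B i)) ->
  sigma_seq X (cylinder X B n).
Proof.
move=> mB.
apply: (@bigcap_measurableType _ (g_sigma_algebraType
  (\bigcup_n g_sigma_algebra_preimage (X n)))) => i _.
apply: sub_sigma_algebra; exists i => //.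
by exists (B i) => //; rewrite setTI.
Qed.

Hypotheses (iU : mutually_independent U) (iV : mutually_independent V).
Hypothesis iUV : independent_seq U V.

(** Only a pi-system: the filtration is [<<s past n >>]. It involves the draws of index below [n],
    exactly those from which the urn at time [n] is built. *)
Definition past (n : nat) : set (set T) :=
  [set A | exists E F, [/\ forall i, measurable (E i), forall i, measurable (F i)
    & A = cylinder U E n `&` cylinder V F n]].

Lemma measurable_past n : past n `<=` measurable.
Proof.
move=> _ [E [F [mE mF ->]]]; apply: measurableI; exact: measurable_cylinder.
Qed.

Lemma past_setT n : past n setT.
Proof.
exists (fun=> setT), (fun=> setT); split => //.
by apply/seteqP; split.
Qed.

Lemma past_setI n : setI_closed (past n).
Proof.
move=> _ _ [E [F [mE mF ->]]] [E' [F' [mE' mF' ->]]].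
exists (fun i => E i `&` E' i), (fun i => F i `&` F' i); split.
- by move=> i; exact: measurableI.
- by move=> i; exact: measurableI.
by rewrite /cylinder setIACA -!bigcapI.
Qed.

Lemma past_mono n k : (n <= k)%N -> past n `<=` past k.
Proof.
move=> nk _ [E [F [mE mF ->]]].
exists (fun i => if (i < n)%N then E i else setT),
  (fun i => if (i < n)%N then F i else setT); split.
- by move=> i; case: ifP.
- by move=> i; case: ifP.
suff h d' (T' : measurableType d') (X : nat -> {RV P >-> T'}) B :
    cylinder X B n = cylinder X (fun i => if (i < n)%N then B i else setT) k.
  by rewrite -!h.
apply/seteqP; split => [w Bw i _ /=|w Bw i/=].
  by case: ifPn => // ni; apply: Bw; rewrite /= in_initial_segment.
rewrite in_initial_segment => ni; have /= := Bw i; rewrite ni; apply.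
by rewrite in_initial_segment (leq_trans ni).
Qed.

Lemma probability_cylinder d' {T' : measurableType d'} (X : nat -> {RV P >-> T'})
  (B : nat -> set T') n : mutually_independent X -> (forall i, measurable (B i)) ->
  P (cylinder X B n) = (\prod_(i < n) P (X i @^-1` B i))%E.
Proof. by move=> iX mB; rewrite iX// big_initial_segment. Qed.

Lemma past_preimageU n E : measurable E -> past n.+1 (U n @^-1` E).
Proof.
move=> mE; exists (fun i => if i == n then E else setT), (fun=> setT).
split => //; first by move=> i; case: ifP.
apply/seteqP; split => [w Ew|w [/(_ n) + _]] /=.
  by split=> // i _ /=; case: ifPn => [/eqP ->|].
by rewrite /= in_fset1U !eqxx; exact.
Qed.

Lemma past_preimageV n F : measurable F -> past n.+1 (V n @^-1` F).
Proof.
move=> mF; exists (fun=> setT), (fun i => if i == n then F else setT).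
split => //; first by move=> i; case: ifP.
apply/seteqP; split => [w Fw|w [_ /(_ n)]] /=.
  by split=> // i _ /=; case: ifPn => [/eqP ->|].
by rewrite /= in_fset1U !eqxx; exact.
Qed.

Lemma sigma_seq_preimage d' (T' : measurableType d') (X : nat -> {RV P >-> T'}) n B :
  measurable B -> sigma_seq X (X n @^-1` B).
Proof.
move=> mB; apply: sub_sigma_algebra; exists n => //.
by exists B => //; rewrite setTI.
Qed.

Lemma probability_cylinderS d' (T' : measurableType d') (X : nat -> {RV P >-> T'})
  (B : nat -> set T') n : mutually_independent X -> (forall i, measurable (B i)) ->
  P (cylinder X B n.+1) = (P (cylinder X B n) * P (X n @^-1` B n))%E.
Proof. by move=> iX mB; rewrite !probability_cylinder// big_ord_recr. Qed.

Lemma past_indep_rectangle n (A : set T) E F :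
  past n A -> measurable E -> measurable F ->
  (P (A `&` (U n @^-1` E `&` V n @^-1` F))
   = P A * P (U n @^-1` E `&` V n @^-1` F))%E.
Proof.
move=> [E0 [F0 [mE0 mF0 ->]]] mE mF.
(* Overwriting coordinate [n] leaves cylinders of length [n] unchanged and absorbs the draw at time
   [n] into cylinders of length [n.+1], to which the independence hypotheses apply. *)
pose E1 i := if i == n then E else E0 i; pose F1 i := if i == n then F else F0 i.
have mE1 i : measurable (E1 i) by rewrite /E1; case: ifP.
have mF1 i : measurable (F1 i) by rewrite /F1; case: ifP.
have -> : cylinder U E0 n = cylinder U E1 n.
  by apply: eq_cylinder => i; rewrite /E1 => /ltn_eqF ->.
have -> : cylinder V F0 n = cylinder V F1 n.
  by apply: eq_cylinder => i; rewrite /F1 => /ltn_eqF ->.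
have -> : E = E1 n by rewrite /E1 eqxx.
have -> : F = F1 n by rewrite /F1 eqxx.
rewrite setIACA -!cylinderS !iUV; last 6 first.
- exact: sigma_seq_preimage.
- exact: sigma_seq_preimage.
- exact: sigma_seq_cylinder.
- exact: sigma_seq_cylinder.
- exact: sigma_seq_cylinder.
- exact: sigma_seq_cylinder.
by rewrite !probability_cylinderS// muleACA.
Qed.

Section adapted.
Context d3 {T3 : measurableType d3}.

Definition adapted n (H : T -> T3) :=
  forall C, measurable C -> <<s past n >> (H @^-1` C).

Lemma adapted_measurable n H : adapted n H -> measurable_fun setT H.
Proof.
move=> aH _ C mC; rewrite setTI.
have := aH _ mC; apply: smallest_sub; last exact: measurable_past.
exact: sigma_algebra_measurable.
Qed.

(** Two passes of Dynkin's argument: one over the rectangles generating the events of [(U n, V n)]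
    and, for each rectangle, one over [past n]. *)
Lemma adapted_independent n (H : T -> T3) C B : adapted n H ->
  measurable C -> measurable B ->
  (P (H @^-1` C `&` (fun w => (U n w, V n w)) @^-1` B) =
   P (H @^-1` C) * P ((fun w => (U n w, V n w)) @^-1` B))%E.
Proof.
move=> aH mC mB.
have mHC : measurable (H @^-1` C).
  by rewrite -[X in measurable X]setTI; exact: (adapted_measurable aH).
pose rect := [set D | exists E F, [/\ measurable E, measurable F &
  D = U n @^-1` E `&` V n @^-1` F]].
have mrect : rect `<=` measurable.
  move=> _ [E [F [mE mF ->]]].
  by apply: measurableI; rewrite -[X in measurable X]setTI; exact: measurable_funPT.
rewrite setIC muleC; apply: (@independent_sigma_algebra _ _ _ P rect) => //.
- move=> _ _ [E [F [mE mF ->]]] [E' [F' [mE' mF' ->]]].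
  exists (E `&` E'), (F `&` F'); split; [exact: measurableI|exact: measurableI|].
  by rewrite setIACA.
- by exists setT, setT; split => //; rewrite !preimage_setT setTI.
- move=> _ [E [F [mE mF ->]]]; rewrite setIC muleC.
  apply: (@independent_sigma_algebra _ _ _ P (past n)).
  + exact: measurable_past.
  + exact: past_setI.
  + exact: past_setT.
  + by apply: mrect; exists E, F.
  + by move=> A pA; exact: past_indep_rectangle.
  + exact: aH.
have mU : @measurable_fun _ _ (g_sigma_algebraType rect) T1 setT (U n).
  move=> _ E mE; rewrite setTI; apply: sub_sigma_algebra.
  by exists E, setT; split => //; rewrite preimage_setT setIT.
have mV : @measurable_fun _ _ (g_sigma_algebraType rect) T2 setT (V n).
  move=> _ E mE; rewrite setTI; apply: sub_sigma_algebra.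
  by exists setT, E; split => //; rewrite preimage_setT setTI.
have := measurable_fun_pair mU mV measurableT mB.
by rewrite setTI.
Qed.

(** The freezing form of the Markov property: [H] is held fixed while the next draw is averaged.
    [U n] and [V n] get separate integrals because they are also independent of each other. *)
Lemma integral_adapted n (H : T -> T3) (f : T3 -> T1 -> T2 -> \bar R) :
  adapted n H ->
  measurable_fun setT (fun z : T3 * (T1 * T2) => f z.1 z.2.1 z.2.2) ->
  (forall h u v, 0 <= f h u v)%E ->
  (\int[P]_w f (H w) (U n w) (V n w) =
   \int[P]_w \int[P]_w1 \int[P]_w2 f (H w) (U n w1) (V n w2))%E.
Proof.
move=> aH mf f0.
have mH := adapted_measurable aH.
rewrite (@integral_independent_pair _ _ _ P _ _ _ _ H (fun w => (U n w, V n w))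
  mH _ _ (fun z : T3 * (T1 * T2) => f z.1 z.2.1 z.2.2))//; last 2 first.
- exact: measurable_fun_pair.
- by move=> A B mA mB; exact: adapted_independent.
apply: eq_integral => w _ /=.
rewrite (@integral_independent_pair _ _ _ P _ _ _ _ (U n) (V n)
  _ _ _ (fun z : T1 * T2 => f (H w) z.1 z.2))//.
- by move=> A B mA mB; apply: iUV; exact: sigma_seq_preimage.
- exact: measurableT_comp mf (pair1_measurable (H w)).
Qed.

End adapted.
End driving.

(** * One-step expansions *)

Section potentials.
Context {R : realType}.
Implicit Types (D kappa sigma r t z : R).

(** All rests on the identity [r sigma - t = t * (r sigma)]. Of two factors [r], one is bounded by
    [beta] and one is kept, so that the errors stay linear in [r]. *)
Lemma jump_bounds (S r beta : R) : 0 < S -> 0 <= r <= beta ->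
  let t := r / (S + r) in let sigma := S^-1 in
  [/\ 0 <= t, t <= r * sigma, t <= beta * sigma, t <= 1 &
      0 <= r * sigma - t <= beta * r * sigma ^+ 2].
Proof.
move=> S0 /andP[r0 rb] t sigma.
have Sr : 0 < S + r by rewrite ltr_wpDr.
have s0 : 0 < sigma by rewrite invr_gt0.
have t0 : 0 <= t by rewrite divr_ge0// ltW.
have tE : r * sigma - t = t * (r * sigma).
  by rewrite /t /sigma; field; rewrite !gt_eqF.
have rs0 : 0 <= r * sigma by rewrite mulr_ge0// ltW.
have ts : t <= r * sigma by rewrite -subr_ge0 tE mulr_ge0.
have rbs : r * sigma <= beta * sigma by rewrite ler_pM2r.
split => //.
- exact: le_trans rbs.
- by rewrite ler_pdivrMr// mul1r lerDr ltW.
- rewrite tE mulr_ge0//=.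
  have -> : beta * r * sigma ^+ 2 = (beta * sigma) * (r * sigma) by ring.
  by rewrite ler_wpM2r// (le_trans ts).
Qed.

Section step.
Variables (D kappa sigma r t beta : R).
Hypotheses (D1 : `|D| <= 1) (k1 : `|kappa| <= 1) (s0 : 0 <= sigma)
  (t0 : 0 <= t) (t1 : t <= 1) (trs : t <= r * sigma) (tbs : t <= beta * sigma)
  (rho0 : 0 <= r * sigma - t) (rho1 : r * sigma - t <= beta * r * sigma ^+ 2).

Let t2 : t ^+ 2 <= beta * r * sigma ^+ 2.
Proof.
rewrite expr2 (_ : beta * r * sigma ^+ 2 = (beta * sigma) * (r * sigma)); last by ring.
exact: ler_pM.
Qed.

Let Dk1 : `|D * kappa| <= 1.
Proof. by rewrite normrM mulr_ile1. Qed.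

Let D21 : D ^+ 2 <= 1.
Proof. by rewrite -real_normK ?num_real// exprn_ile1. Qed.

Let kk1 : kappa ^+ 2 <= 1.
Proof. by rewrite -real_normK ?num_real// exprn_ile1. Qed.

(** Multiplied by [sigma], this bounds the change of [D^2/S], which enters both moment potentials.
    The four error terms, each at most [beta r sigma^2], occur with weights 2, 2, 1, 1; hence the
    6. *)
Lemma square_step_le :
  (D + kappa * t) ^+ 2 * (1 - t) - D ^+ 2 <=
  r * (2 * D * kappa * sigma - D ^+ 2 * sigma + 6 * beta * sigma ^+ 2).
Proof.
have [t2' rho1'] := (t2, rho1); set B := beta * r * sigma ^+ 2 in t2' rho1'.
have -> : r * (2 * D * kappa * sigma - D ^+ 2 * sigma + 6 * beta * sigma ^+ 2) =
   2 * D * kappa * (r * sigma) - D ^+ 2 * (r * sigma) + 6 * B by rewrite /B; ring.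
have h1 : - (D * kappa) * (r * sigma - t) <= B.
  apply: le_trans rho1'; rewrite -[leRHS]mul1r ler_wpM2r//.
  by rewrite (le_trans (ler_norm _))// normrN.
have h2 : - (D * kappa) * t ^+ 2 <= B.
  apply: le_trans t2'; rewrite -[leRHS]mul1r ler_wpM2r ?sqr_ge0//.
  by rewrite (le_trans (ler_norm _))// normrN.
have h3 : kappa ^+ 2 * t ^+ 2 * (1 - t) <= B.
  apply: le_trans t2'; rewrite -[leRHS]mulr1; apply: ler_pM.
  - by rewrite mulr_ge0 ?sqr_ge0.
  - by rewrite subr_ge0.
  - by rewrite -[leRHS]mul1r ler_wpM2r ?sqr_ge0.
  - by rewrite gerBl.
have h4 : D ^+ 2 * (r * sigma - t) <= B.
  by apply: le_trans rho1'; rewrite -[leRHS]mul1r ler_wpM2r.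
have -> : (D + kappa * t) ^+ 2 * (1 - t) - D ^+ 2 = 2 * D * kappa * (r * sigma)
  + 2 * (- (D * kappa) * (r * sigma - t)) + 2 * (- (D * kappa) * t ^+ 2)
  + kappa ^+ 2 * t ^+ 2 * (1 - t) - D ^+ 2 * (r * sigma) + D ^+ 2 * (r * sigma - t).
  by ring.
lra.
Qed.

(* The bounds are affine in [r], so that only the mean of the reinforcement enters
   once [r] is averaged; to this end [t^2] is minorized by its tangent at
   [t = m sigma]. *)
Lemma second_moment_step (m c K : R) : 0 <= m -> 0 <= c -> 0 <= K ->
  D ^+ 2 + c * sigma - K * D ^+ 2 * sigma - kappa ^+ 2 * m ^+ 2 * sigma ^+ 2 +
  (2 * D * kappa * sigma - 2 * `|D| * `|kappa| * beta * sigma ^+ 2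
   + kappa ^+ 2 * (2 * m * sigma ^+ 2 - 2 * m * beta * sigma ^+ 3) - c * sigma ^+ 2
   - K * sigma * (2 * D * kappa * sigma - D ^+ 2 * sigma + 6 * beta * sigma ^+ 2)) * r <=
  (D + kappa * t) ^+ 2 + c * (sigma * (1 - t))
  - K * (D + kappa * t) ^+ 2 * (sigma * (1 - t)).
Proof.
move=> m0 c0 K0.
have hK := ler_wpM2l (mulr_ge0 K0 s0) square_step_le.
have h1 : - (D * kappa) * (r * sigma - t) >= - (`|D| * `|kappa|) * (beta * r * sigma ^+ 2).
  rewrite !mulNr lerN2 -normrM (@le_trans _ _ (`|D * kappa| * (r * sigma - t)))//.
    by rewrite ler_wpM2r// ler_norm.
  by rewrite ler_wpM2l.
have h2 : kappa ^+ 2 * (2 * m * sigma * (r * sigma - beta * r * sigma ^+ 2) - m ^+ 2 * sigma ^+ 2)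
    <= kappa ^+ 2 * t ^+ 2.
  rewrite ler_wpM2l ?sqr_ge0//.
  have : 0 <= (t - m * sigma) ^+ 2 by exact: sqr_ge0.
  have : 0 <= 2 * m * sigma * (t - (r * sigma - beta * r * sigma ^+ 2)).
    by apply: mulr_ge0; [rewrite !mulr_ge0|move: rho1; lra].
  lra.
have h3 : c * sigma * t <= c * sigma * (r * sigma) by rewrite ler_wpM2l ?mulr_ge0.
lra.
Qed.

(** In the binomial expansion the cubic term is split by AM-GM. The [D^2 beta sigma^2] errors then
    have weights 4 (replacing [t] by [r sigma] in the linear term), 6 (quadratic term) and 2 (cubic
    term), giving 12; the [t^4] errors have weights 1 and 2, giving 3. *)
Lemma fourth_moment_step (a b : R) : 0 <= a -> 0 <= b ->
  (D + kappa * t) ^+ 4 + a * (D + kappa * t) ^+ 2 * (sigma * (1 - t))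
    + b * (sigma * (1 - t)) ^+ 2 <=
  D ^+ 4 + a * D ^+ 2 * sigma + b * sigma ^+ 2 +
  (4 * D ^+ 3 * kappa * sigma + 12 * D ^+ 2 * beta * sigma ^+ 2 + 3 * beta ^+ 3 * sigma ^+ 4
   + a * sigma * (2 * D * kappa * sigma - D ^+ 2 * sigma + 6 * beta * sigma ^+ 2)
   - b * sigma ^+ 3 * (1 - beta * sigma)) * r.
Proof.
move=> a0 b0.
have ha := ler_wpM2l (mulr_ge0 a0 s0) square_step_le.
have hb : b * sigma ^+ 2 * (t ^+ 2 - 2 * t) <=
    - (b * sigma ^+ 2 * (r * sigma - beta * r * sigma ^+ 2)).
  rewrite -[leRHS]mulrN; apply: ler_wpM2l; first by rewrite mulr_ge0 ?sqr_ge0.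
  have : t ^+ 2 <= t by rewrite expr2 -[leRHS]mul1r ler_wpM2r.
  by move: rho1; lra.
have D2 := sqr_ge0 D.
have h1 : - (D ^+ 3 * kappa) * (r * sigma - t) <= D ^+ 2 * (beta * r * sigma ^+ 2).
  have -> : - (D ^+ 3 * kappa) * (r * sigma - t) =
    D ^+ 2 * (- (D * kappa) * (r * sigma - t)) by ring.
  rewrite ler_wpM2l// (le_trans _ rho1)// -[leRHS]mul1r ler_wpM2r//.
  by rewrite (le_trans (ler_norm _))// normrN.
have h2 : D ^+ 2 * kappa ^+ 2 * t ^+ 2 <= D ^+ 2 * (beta * r * sigma ^+ 2).
  by rewrite -mulrA ler_wpM2l// (le_trans _ t2)// -[leRHS]mul1r ler_wpM2r ?sqr_ge0.
have t4 : t ^+ 4 <= beta ^+ 3 * sigma ^+ 4 * r.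
  have -> : beta ^+ 3 * sigma ^+ 4 * r = (beta * sigma) ^+ 3 * (r * sigma) by ring.
  by rewrite exprSr ler_pM ?exprn_ge0// lerXn2r ?nnegrE// (le_trans t0).
have k2t : kappa ^+ 2 * t ^+ 2 <= t ^+ 2 by rewrite -[leRHS]mul1r ler_wpM2r ?sqr_ge0.
have k4t : kappa ^+ 4 * t ^+ 4 <= t ^+ 4.
  have -> : kappa ^+ 4 * t ^+ 4 = (kappa ^+ 2 * t ^+ 2) * (kappa ^+ 2 * t ^+ 2) by ring.
  have -> : t ^+ 4 = t ^+ 2 * t ^+ 2 by ring.
  by apply: ler_pM => //; rewrite mulr_ge0 ?sqr_ge0.
(* AM-GM: 4 D e^3 <= 2 D^2 e^2 + 2 e^4 for the jump e = kappa t *)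
have h3 : 4 * D * (kappa * t) ^+ 3 <=
    2 * (D ^+ 2 * kappa ^+ 2 * t ^+ 2) + 2 * (kappa ^+ 4 * t ^+ 4).
  by have := mulr_ge0 (sqr_ge0 (kappa * t)) (sqr_ge0 (D - kappa * t)); lra.
have -> : (D + kappa * t) ^+ 4 = D ^+ 4 + 4 * (D ^+ 3 * kappa) * (r * sigma)
   + 4 * (- (D ^+ 3 * kappa) * (r * sigma - t)) + 6 * (D ^+ 2 * kappa ^+ 2 * t ^+ 2)
   + 4 * D * (kappa * t) ^+ 3 + kappa ^+ 4 * t ^+ 4 by ring.
lra.
Qed.

End step.
End potentials.

(** * Drift of the moment potentials, averaged over the drawn color *)

Section drift.
Context {R : realType}.
Implicit Types (b : R * R).

Definition proportion b := b.1 / (b.1 + b.2).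
Definition inv_total b := (b.1 + b.2)^-1.

Definition second_moment (p c K : R) b :=
  let D := proportion b - p in
  D ^+ 2 + c * inv_total b - K * D ^+ 2 * inv_total b.

Definition fourth_moment (p a e : R) b :=
  let D := proportion b - p in
  D ^+ 4 + a * D ^+ 2 * inv_total b + e * inv_total b ^+ 2.

Section one_state.
Variables (X Y beta m p : R).
Hypotheses (X0 : 0 < X) (Y0 : 0 < Y) (beta0 : 0 < beta) (m0 : 0 < m)
  (p01 : 0 <= p <= 1).
Let S := X + Y.
Let z := X / S.
Let sigma := S^-1.
Let D := z - p.

Let S0 : 0 < S. Proof. exact: addr_gt0. Qed.
Let s0 : 0 < sigma. Proof. by rewrite invr_gt0. Qed.
Let z0 : 0 <= z. Proof. by rewrite divr_ge0 ?ltW. Qed.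
Let z1 : z <= 1. Proof. by rewrite ler_pdivrMr// mul1r lerDl ltW. Qed.
Let D1 : `|D| <= 1.
Proof. by case/andP: p01 => *; rewrite ler_norml /D; apply/andP; split; move: z0 z1; lra. Qed.

Let YE : Y / (X + Y) = 1 - z.
Proof. by rewrite /z /S; field; rewrite gt_eqF. Qed.

Let jumpX r : 0 <= r ->
  proportion (X + r, Y) - p = D + (1 - z) * (r / (S + r)) /\
  inv_total (X + r, Y) = sigma * (1 - r / (S + r)).
Proof.
move=> r0; have Sr : 0 < S + r by rewrite ltr_wpDr.
rewrite /proportion /inv_total/= /D /sigma /z addrAC /S; split;
  by field; rewrite !gt_eqF.
Qed.

Let jumpY r : 0 <= r ->
  proportion (X, Y + r) - p = D + (- z) * (r / (S + r)) /\
  inv_total (X, Y + r) = sigma * (1 - r / (S + r)).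
Proof.
move=> r0; have Sr : 0 < S + r by rewrite ltr_wpDr.
rewrite /proportion /inv_total/= /D /sigma /z addrA /S; split;
  by field; rewrite !gt_eqF.
Qed.

Let kX : `|1 - z| <= 1. Proof. by rewrite ger0_norm; move: z0 z1; lra. Qed.
Let kY : `|- z| <= 1. Proof. by rewrite normrN ger0_norm. Qed.

(** The averaged minorant exceeds the present value by exactly [m sigma^2] times the expression in
    [main]. Near [p] the variance gain, about [m z (1 - z)], outweighs the loss [c]; away from [p]
    the term [K D^2] takes over. The terms linear in [D kappa] vanish, as [kappa] is [1 - z] with
    weight [z] and [- z] with weight [1 - z]. *)
Lemma second_moment_drift c K :
  0 < p < 1 ->
  c = m * (p * (1 - p)) / 8 ->
  K = (m / 2 + beta) ^+ 2 / (m * (p * (1 - p))) ->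
  beta * sigma <= 4^-1 ->
  6 * K * beta * sigma <= m * (p * (1 - p)) / 8 ->
  exists A0 A1 B0 B1, [/\
    forall r, 0 <= r <= beta -> A0 + A1 * r <= second_moment p c K (X + r, Y),
    forall r, 0 <= r <= beta -> B0 + B1 * r <= second_moment p c K (X, Y + r) &
    second_moment p c K (X, Y) <=
      X / (X + Y) * (A0 + A1 * m) + Y / (X + Y) * (B0 + B1 * m)].
Proof.
move=> /andP[p0 p1] cE KE bs1 bs2.
have pi0 : 0 < p * (1 - p) by rewrite mulr_gt0// subr_gt0.
have mpi0 : 0 < m * (p * (1 - p)) by exact: mulr_gt0.
have c0 : 0 <= c by rewrite cE divr_ge0// ltW.
have K0 : 0 <= K by rewrite KE divr_ge0 ?sqr_ge0 ?(ltW mpi0).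
pose lin0 kappa := D ^+ 2 + c * sigma - K * D ^+ 2 * sigma - kappa ^+ 2 * m ^+ 2 * sigma ^+ 2.
pose lin1 kappa := 2 * D * kappa * sigma - 2 * `|D| * `|kappa| * beta * sigma ^+ 2
   + kappa ^+ 2 * (2 * m * sigma ^+ 2 - 2 * m * beta * sigma ^+ 3) - c * sigma ^+ 2
   - K * sigma * (2 * D * kappa * sigma - D ^+ 2 * sigma + 6 * beta * sigma ^+ 2).
exists (lin0 (1 - z)), (lin1 (1 - z)), (lin0 (- z)), (lin1 (- z)); split.
- move=> r r0b; have [t0 ts tb t1 /andP[rho0 rho1]] := jump_bounds S0 r0b.
  case/andP: (r0b) => r0 _; have [h1 h2] := jumpX r0.
  rewrite /second_moment h1 h2.
  exact: (second_moment_step D1 kX (ltW s0) t0 t1 ts tb rho0 rho1 (ltW m0) c0 K0).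
- move=> r r0b; have [t0 ts tb t1 /andP[rho0 rho1]] := jump_bounds S0 r0b.
  case/andP: (r0b) => r0 _; have [h1 h2] := jumpY r0.
  rewrite /second_moment h1 h2.
  exact: (second_moment_step D1 kY (ltW s0) t0 t1 ts tb rho0 rho1 (ltW m0) c0 K0).
have DD : `|D| ^+ 2 = D ^+ 2 by rewrite real_normK ?num_real.
have zz0 : 0 <= z * (1 - z) by rewrite mulr_ge0// subr_ge0.
have zz4 : 4 * (z * (1 - z)) <= 1 by have := sqr_ge0 (2 * z - 1); lra.
have zzpi : p * (1 - p) - `|D| <= z * (1 - z).
  rewrite lerBlDl -lerBlDr.
  have -> : p * (1 - p) - z * (1 - z) = D * (z + p - 1) by rewrite /D; ring.
  rewrite (le_trans (ler_norm _))// normrM -[leRHS]mulr1 ler_wpM2l//.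
  by rewrite ler_norml; apply/andP; split; move: z0 z1 p0 p1; lra.
(* [K] makes the discriminant of this quadratic in [`|D|] vanish. *)
have disc : 0 <= K * D ^+ 2 - (m / 2 + beta) * `|D| + m * (p * (1 - p)) / 4.
  rewrite -DD KE.
  have -> : (m / 2 + beta) ^+ 2 / (m * (p * (1 - p))) * `|D| ^+ 2 - (m / 2 + beta) * `|D|
      + m * (p * (1 - p)) / 4
    = ((m / 2 + beta) * `|D| - m * (p * (1 - p)) / 2) ^+ 2 / (m * (p * (1 - p))).
    by field; rewrite subr_eq0 !gt_eqF.
  by rewrite divr_ge0 ?sqr_ge0 ?(ltW mpi0).
(* The budget: since [beta sigma <= 1/4], half of [m z (1 - z)] survives, which is at least
   [m (p (1 - p) - |D|) / 2]. The terms [c] and [6 K beta sigma] cost at most [m p (1 - p) / 8]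
   each, which leaves the constant [m p (1 - p) / 4] of [disc]. *)
have main : 0 <= z * (1 - z) * m * (1 - 2 * (beta * sigma)) - 4 * `|D| * (z * (1 - z)) * beta
    - c + K * D ^+ 2 - 6 * K * beta * sigma.
  have h1 : z * (1 - z) * m * 2^-1 <= z * (1 - z) * m * (1 - 2 * (beta * sigma)).
    by apply: ler_wpM2l; [rewrite mulr_ge0// ltW|lra].
  have h2 : 4 * `|D| * (z * (1 - z)) * beta <= `|D| * beta.
    by rewrite ler_wpM2r ?(ltW beta0)// mulrAC -[leRHS]mul1r ler_wpM2r.
  have h3 : (p * (1 - p) - `|D|) * m <= z * (1 - z) * m by rewrite ler_wpM2r// ltW.
  lra.
rewrite -/S -/z [Y / S]YE.
have h := mulr_ge0 (mulr_ge0 (ltW m0) (sqr_ge0 sigma)) main.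
rewrite -subr_ge0; apply: (le_trans h); rewrite le_eqVlt; apply/orP; left; apply/eqP.
rewrite /second_moment /lin0 /lin1 /proportion/inv_total/= -/S -/z -/D -/sigma.
have nz : `|1 - z| = 1 - z by rewrite ger0_norm ?subr_ge0.
rewrite normrN (ger0_norm z0) nz.
ring.
Qed.

(** The choice [a = 12 beta] cancels the terms in [D^2 sigma^2]. In units of [m beta^2 sigma^3]
    there remain the error [6 a beta], worth 72, and the gain 100 from [e]. The surplus 28 covers
    the remaining [103 beta sigma], at most 25.75. *)
Lemma fourth_moment_drift a e :
  a = 12 * beta -> e = 100 * beta ^+ 2 -> beta * sigma <= 4^-1 ->
  exists A0 A1 B0 B1, [/\
    forall r, 0 <= r <= beta -> fourth_moment p a e (X + r, Y) <= A0 + A1 * r,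
    forall r, 0 <= r <= beta -> fourth_moment p a e (X, Y + r) <= B0 + B1 * r &
      X / (X + Y) * (A0 + A1 * m) + Y / (X + Y) * (B0 + B1 * m)
      <= fourth_moment p a e (X, Y)].
Proof.
move=> aE eE bs1.
have a0 : 0 <= a by rewrite aE mulr_ge0// ltW.
have e0 : 0 <= e by rewrite eE mulr_ge0// sqr_ge0.
pose Q := D ^+ 4 + a * D ^+ 2 * sigma + e * sigma ^+ 2.
pose lin1 kappa := 4 * D ^+ 3 * kappa * sigma + 12 * D ^+ 2 * beta * sigma ^+ 2
  + 3 * beta ^+ 3 * sigma ^+ 4
   + a * sigma * (2 * D * kappa * sigma - D ^+ 2 * sigma + 6 * beta * sigma ^+ 2)
   - e * sigma ^+ 3 * (1 - beta * sigma).
exists Q, (lin1 (1 - z)), Q, (lin1 (- z)); split.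
- move=> r r0b; have [t0 ts tb t1 /andP[rho0 rho1]] := jump_bounds S0 r0b.
  case/andP: (r0b) => r0 _; have [h1 h2] := jumpX r0.
  rewrite /fourth_moment h1 h2.
  exact: (fourth_moment_step D1 kX (ltW s0) t0 t1 ts tb rho0 rho1 a0 e0).
- move=> r r0b; have [t0 ts tb t1 /andP[rho0 rho1]] := jump_bounds S0 r0b.
  case/andP: (r0b) => r0 _; have [h1 h2] := jumpY r0.
  rewrite /fourth_moment h1 h2.
  exact: (fourth_moment_step D1 kY (ltW s0) t0 t1 ts tb rho0 rho1 a0 e0).
have main : 0 <= 28 * beta ^+ 2 - 100 * beta ^+ 2 * (beta * sigma) - 3 * beta ^+ 2 * (beta * sigma).
  have : beta ^+ 2 * (beta * sigma) <= beta ^+ 2 * 4^-1 by rewrite ler_wpM2l// sqr_ge0.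
  have := sqr_ge0 beta; lra.
rewrite -/S -/z [Y / S]YE.
have h := mulr_ge0 (mulr_ge0 (ltW m0) (exprn_ge0 3 (ltW s0))) main.
rewrite -subr_ge0; apply: (le_trans h); rewrite le_eqVlt; apply/orP; left; apply/eqP.
rewrite /fourth_moment /Q /lin1 /proportion/inv_total/= -/S -/z -/D -/sigma aE eE.
ring.
Qed.

End one_state.
End drift.

(** * Potentials for the growth of the total and for the endpoints *)

Section exponential_and_logarithm.
Context {R : realType}.
Variables (X Y beta m : R).
Hypotheses (X0 : 0 < X) (Y0 : 0 < Y) (beta0 : 0 < beta).

(** From [exp (-r) <= 1/(1+r) = 1 - r/(1+r) <= 1 - r/(1+beta)], which is affine in [r]. The factor
    is below 1 when [m > 0], so the mean of [exp (-S)] decays geometrically. *)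
Lemma exponential_drift :
  exists A0 A1 B0 B1, [/\
    forall r, 0 <= r <= beta -> expR (- (X + r + Y)) <= A0 + A1 * r,
    forall r, 0 <= r <= beta -> expR (- (X + (Y + r))) <= B0 + B1 * r &
    X / (X + Y) * (A0 + A1 * m) + Y / (X + Y) * (B0 + B1 * m) <=
      (1 - m / (1 + beta)) * expR (- (X + Y))].
Proof.
pose e := expR (- (X + Y)).
have key r : 0 <= r <= beta -> expR (- (X + Y + r)) <= e + - (e / (1 + beta)) * r.
  move=> /andP[r0 rb]; rewrite opprD expRD -/e.
  have -> : e + - (e / (1 + beta)) * r = e * (1 - r / (1 + beta)) by ring.
  rewrite ler_wpM2l ?expR_ge0// expRN.
  have r1 : 0 < 1 + r by rewrite ltr_wpDr.
  apply: (@le_trans _ _ (1 + r)^-1).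
    by rewrite lef_pV2 ?posrE ?expR_gt0 ?expR_ge1Dx.
  have -> : (1 + r)^-1 = 1 - r / (1 + r) by field; rewrite gt_eqF.
  by rewrite lerD2l lerN2 ler_wpM2l// lef_pV2 ?posrE ?lerD2l ?(addr_gt0 ltr01 beta0).
exists e, (- (e / (1 + beta))), e, (- (e / (1 + beta))); split.
- by move=> r rb; rewrite addrAC key.
- by move=> r rb; rewrite addrA key.
rewrite -/e -mulrDl -mulrDl divff ?gt_eqF ?addr_gt0// le_eqVlt.
by apply/orP; left; apply/eqP; ring.
Qed.

Definition log_potential (b : R * R) := ln ((b.1 + b.2) / b.1) + beta / b.1.

Lemma log_potential_ge0 : 0 <= log_potential (X, Y).
Proof.
apply: addr_ge0; last by rewrite divr_ge0// ltW.
by rewrite ln_ge0// ler_pdivlMr// mul1r lerDl ltW.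
Qed.

(** The logarithm alone yields only [- r/(X+r)] when the first color is drawn; the decrease of
    [beta/X] makes up the difference to [- r/X], precisely because [r <= beta]. With slopes
    [1/S - 1/X] and [1/S] the average drift is then exactly zero. *)
Lemma log_potential_drift :
  exists A0 A1 B0 B1, [/\
    forall r, 0 <= r <= beta -> log_potential (X + r, Y) <= A0 + A1 * r,
    forall r, 0 <= r <= beta -> log_potential (X, Y + r) <= B0 + B1 * r &
    X / (X + Y) * (A0 + A1 * m) + Y / (X + Y) * (B0 + B1 * m) <=
      log_potential (X, Y)].
Proof.
have S0 : 0 < X + Y by exact: addr_gt0.
have ln_le (u : R) : 0 < u -> ln u <= u - 1.
  by move=> u0; rewrite lerBrDl -[leRHS]lnK ?posrE// expR_ge1Dx.
have lnS r : 0 <= r -> ln (X + Y + r) <= ln (X + Y) + r / (X + Y).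
  move=> r0; have Sr : 0 < X + Y + r by rewrite ltr_wpDr.
  rewrite -lerBlDl -ln_div ?posrE//; apply: le_trans (ln_le _ (divr_gt0 Sr S0)) _.
  by rewrite le_eqVlt; apply/orP; left; apply/eqP; field; rewrite gt_eqF.
pose psi := log_potential (X, Y).
have psiE : psi = ln (X + Y) - ln X + beta / X by rewrite /psi /log_potential ln_div ?posrE.
exists psi, ((X + Y)^-1 - X^-1), psi, (X + Y)^-1; split.
- move=> r /andP[r0 rb]; rewrite /log_potential/= addrAC.
  have Sr : 0 < X + Y + r by rewrite ltr_wpDr.
  have Xr : 0 < X + r by rewrite ltr_wpDr.
  rewrite ln_div ?posrE// psiE.
  have h1 := lnS r r0.
  have h2 : ln X - ln (X + r) <= X / (X + r) - 1.
    by rewrite -ln_div ?posrE// ln_le// divr_gt0.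
  have h3 : X / (X + r) - 1 + beta / (X + r) <= beta / X - r / X.
    rewrite -subr_ge0.
    have -> : beta / X - r / X - (X / (X + r) - 1 + beta / (X + r)) =
      r * (beta - r) / (X * (X + r)) by field; rewrite !gt_eqF.
    by apply: divr_ge0; rewrite mulr_ge0 ?subr_ge0// ltW.
  by move: h1 h2 h3; lra.
- move=> r /andP[r0 rb]; rewrite /log_potential/= addrA.
  have Sr : 0 < X + Y + r by rewrite ltr_wpDr.
  by rewrite ln_div ?posrE// psiE; move: (lnS r r0); lra.
rewrite -/psi le_eqVlt; apply/orP; left; apply/eqP.
by field; rewrite !gt_eqF.
Qed.

Lemma log_potential_ge (N : nat) : X / (X + Y) <= expR (- N%:R) ->
  N%:R <= log_potential (X, Y).
Proof.
move=> h; have S0 : 0 < X + Y by exact: addr_gt0.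
rewrite /log_potential/=; apply: ler_wpDr; first by rewrite divr_ge0// ltW.
rewrite -[leLHS]expRK ler_ln ?posrE ?expR_gt0 ?divr_gt0//.
have -> : (X + Y) / X = (X / (X + Y))^-1 by rewrite invf_div.
by rewrite -[leLHS]invrK -expRN lef_pV2 ?posrE ?expR_gt0 ?divr_gt0.
Qed.

End exponential_and_logarithm.

Lemma measurable_funV d (T : measurableType d) (R : realType) (D : set T) (f : T -> R) :
  measurable_fun D f -> measurable_fun D (fun t => (f t)^-1).
Proof.
move=> mf.
rewrite (_ : (fun t => (f t)^-1) = (fun t => f t * powR (f t ^+ 2) (-1))).
  apply: measurable_funM => //.
  by apply: (measurableT_comp (measurable_powR (-1))); exact: measurable_funX.
(* also at the junk value: [powR 0 (-1) = 0 = 0^-1] *)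
apply/funext => t; rewrite powR_inv1 ?sqr_ge0//.
have [->|f0] := eqVneq (f t) 0; first by rewrite invr0 mul0r.
by rewrite expr2 invfM mulrA divff ?mul1r.
Qed.

(** * Continuous cutoffs, bounded convergence, measurability *)

Section tent.
Context {R : realType}.
Implicit Types e u : R.

Definition tent e u := Num.max 0 (1 - `|u| / e).

Lemma tent_ge0 e u : 0 <= tent e u. Proof. by rewrite le_max lexx. Qed.

Lemma tent_le1 e u : 0 < e -> tent e u <= 1.
Proof. by move=> e0; rewrite ge_max ler01/= gerBl divr_ge0// ltW. Qed.

Lemma tent0 e : tent e 0 = 1.
Proof. by rewrite /tent normr0 mul0r subr0 max_r. Qed.

Lemma tent_eq0 e u : 0 < e -> e <= `|u| -> tent e u = 0.
Proof. by move=> e0 eu; rewrite /tent max_l// subr_le0 ler_pdivlMr ?mul1r. Qed.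

Lemma tent_neq0 e u : 0 < e -> tent e u != 0 -> `|u| < e.
Proof. by move=> e0; rewrite ltNge; apply: contra => /(tent_eq0 e0) ->; rewrite eqxx. Qed.

Lemma continuous_tent e : continuous (tent e).
Proof.
move=> u; apply: (@continuous_max _ _ (cst 0) (fun u => 1 - `|u| / e)).
  exact: cvg_cst.
apply: cvgB; first exact: cvg_cst.
by apply: cvgM; [exact: norm_continuous|exact: cvg_cst].
Qed.

Lemma measurable_tent e : measurable_fun setT (tent e).
Proof. apply: continuous_measurable_fun; exact: continuous_tent. Qed.

End tent.

Section bounded_convergence.
Context d {T : measurableType d} {R : realType} (P : probability T R).

Lemma bounded_cvg_integral (f : nat -> T -> R) (g : T -> R) (M : R) :
  (forall n, measurable_fun setT (f n)) -> measurable_fun setT g ->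
  (forall n w, `|f n w| <= M) ->
  {ae P, forall w, f n w @[n --> \oo] --> g w} ->
  (\int[P]_w (f n w)%:E)%E @[n --> \oo] --> (\int[P]_w (g w)%:E)%E.
Proof.
move=> mf mg fM fg.
have [] := @dominated_convergence _ _ _ P setT measurableT
  (fun n w => (f n w)%:E) (fun w => (g w)%:E) (fun=> M%:E).
- by move=> n; exact/measurable_EFinP.
- exact/measurable_EFinP.
- apply: filterS fg => w fgw _.
  exact/(cvg_comp _ _ fgw).
- exact: finite_measure_integrable_cst.
- by apply: aeW => w n _; rewrite lee_fin.
by [].
Qed.

End bounded_convergence.

Section measurable_potentials.
Context {R : realType}.

Lemma measurable_proportion : measurable_fun setT (@proportion R).
Proof.
apply: measurable_funM => //; apply: measurable_funV; exact: measurable_funD.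
Qed.

Lemma measurable_inv_total : measurable_fun setT (@inv_total R).
Proof. apply: measurable_funV; exact: measurable_funD. Qed.

Lemma measurable_second_moment p c K : measurable_fun setT (@second_moment R p c K).
Proof.
have mD : measurable_fun setT (fun b : R * R => (proportion b - p) ^+ 2).
  by apply: measurable_funX; apply: measurable_funB => //; exact: measurable_proportion.
apply: measurable_funB; last first.
  apply: measurable_funM; first exact: measurable_funM.
  exact: measurable_inv_total.
apply: measurable_funD => //; apply: measurable_funM => //.
exact: measurable_inv_total.
Qed.

Lemma measurable_fourth_moment p a e : measurable_fun setT (@fourth_moment R p a e).
Proof.
have mD : measurable_fun setT (fun b : R * R => proportion b - p).
  by apply: measurable_funB => //; exact: measurable_proportion.
apply: measurable_funD; first (apply: measurable_funD; first exact: measurable_funX).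
  apply: measurable_funM; last exact: measurable_inv_total.
  by apply: measurable_funM => //; exact: measurable_funX.
by apply: measurable_funM => //; apply: measurable_funX; exact: measurable_inv_total.
Qed.

Lemma proportion_ge0 (b : R * R) : 0 < b.1 -> 0 < b.2 -> 0 <= proportion b.
Proof. by move=> b1 b2; rewrite divr_ge0 ?addr_ge0 ?ltW. Qed.

Lemma proportion_le1 (b : R * R) : 0 < b.1 -> 0 < b.2 -> proportion b <= 1.
Proof. by move=> b1 b2; rewrite ler_pdivrMr ?addr_gt0// mul1r lerDl ltW. Qed.

End measurable_potentials.

(** * The urn as a Markov chain *)

Section bounded_expectation.
Context d {T : measurableType d} {R : realType} (P : probability T R).
Variables (Z : T -> R) (beta m : R).
Hypotheses (mZ : measurable_fun setT Z) (Z0b : forall w, 0 <= Z w <= beta).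
Hypothesis EZ : (\int[P]_w (Z w)%:E = m%:E)%E.

Let iZ : P.-integrable setT (EFin \o Z).
Proof.
apply: measurable_bounded_integrable => //.
  by rewrite (le_lt_trans (probability_le1 _ _))// ltry.
exists beta; split; first exact: num_real.
move=> M bM w _; have /andP[Z0 Zb] := Z0b w.
by rewrite /= ger0_norm// (le_trans Zb)// ltW.
Qed.

Let iaff a b : P.-integrable setT (EFin \o (fun w => a + b * Z w)).
Proof.
rewrite (_ : _ \o _ = (fun=> a%:E) \+ (fun w => b%:E * (Z w)%:E))%E; last first.
  by apply/funext => w /=; rewrite EFinD EFinM.
apply: integrableD => //; first exact: finite_measure_integrable_cst.
exact: integrableZl.
Qed.

Let integral_affine a b : (\int[P]_w (a + b * Z w)%:E = (a + b * m)%:E)%E.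
Proof.
under eq_integral do rewrite EFinD EFinM.
rewrite integralD//; last 2 first.
- exact: finite_measure_integrable_cst.
- exact: integrableZl.
by rewrite integralZl// EZ integral_cst//= probability_setT mule1.
Qed.

(** Converts the affine bounds of the drift lemmas into bounds on expectations. The minorant may be
    negative where [g] is not, hence the detour through its positive part. *)
Lemma affine_minorant_expectation (g : R -> R) a b :
  measurable_fun setT g -> (forall r, 0 <= g r) ->
  (forall r, 0 <= r <= beta -> a + b * r <= g r) ->
  ((a + b * m)%:E <= \int[P]_w (g (Z w))%:E)%E.
Proof.
move=> mg g0 gab; rewrite -integral_affine.
apply: (@le_trans _ _ (\int[P]_w (Num.max 0 (a + b * Z w))%:E)%E).
  apply: le_integral => //; first exact: iaff.
    rewrite (_ : (fun w => (Num.max 0 (a + b * Z w))%:E) =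
        (EFin \o (fun w => (a + b * Z w)%R))^\+%E).
      exact: integrable_funepos.
    by apply/funext => w; rewrite funeposE EFin_max maxC.
  by move=> w _; rewrite lee_fin le_max lexx orbT.
apply: ge0_le_integral => //.
- by move=> w _; rewrite lee_fin le_max lexx.
- apply/measurable_EFinP; apply: (measurable_maxr (f := cst 0)) => //.
  by apply: measurable_funD => //; exact: measurable_funM.
- by apply/measurable_EFinP; exact: measurableT_comp.
- by move=> w _; rewrite lee_fin ge_max g0 gab.
Qed.

Lemma affine_majorant_expectation (g : R -> R) a b :
  measurable_fun setT g -> (forall r, 0 <= g r) ->
  (forall r, 0 <= r <= beta -> g r <= a + b * r) ->
  (\int[P]_w (g (Z w))%:E <= (a + b * m)%:E)%E.
Proof.
move=> mg g0 gab; rewrite -integral_affine.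
apply: ge0_le_integral => //.
- by move=> w _; rewrite lee_fin.
- by apply/measurable_EFinP; exact: measurableT_comp.
- apply/measurable_EFinP.
  by apply: measurable_funD => //; exact: measurable_funM.
- by move=> w _; rewrite lee_fin gab.
Qed.

End bounded_expectation.

Section adapted_processes.
Context d {T : measurableType d} {R : realType} (P : probability T R).
Context d1 d2 {T1 : measurableType d1} {T2 : measurableType d2}.
Variables (U : nat -> {RV P >-> T1}) (V : nat -> {RV P >-> T2}).

Local Notation past := (past U V).
Local Notation past_type n := (g_sigma_algebraType (past n)).

Lemma adaptedP d3 (T3 : measurableType d3) n (H : T -> T3) :
  adapted U V n H <-> @measurable_fun _ _ (past_type n) T3 setT H.
Proof.
split=> [aH _ C mC|mH C mC]; first by rewrite setTI; exact: aH.
by have := mH measurableT _ mC; rewrite setTI.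
Qed.

Lemma adapted_mono d3 (T3 : measurableType d3) n k (H : T -> T3) : (n <= k)%N ->
  adapted U V n H -> adapted U V k H.
Proof.
move=> nk aH C mC; have := aH C mC; apply: sub_smallest2r; last exact: past_mono.
exact: smallest_sigma_algebra.
Qed.

End adapted_processes.

Section urn_process.
Context {R : realType} d {T : measurableType d} (P : probability T R).
Variables (U : nat -> {RV P >-> R}) (VW : nat -> {RV P >-> (R * R)%type}).
Hypothesis hdriving : rru_driving U VW.
Variables (beta : R) (mu nu : probability (measurableTypeR R) R).
Hypotheses (hbeta : 0 < beta) (hmu : mu `[0, beta]%classic = 1%E)
  (hnu : nu `[0, beta]%classic = 1%E).
Variables (m x y : R).
Hypotheses (hmean_mu : mean mu = m%:E) (hmean_nu : mean nu = m%:E).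
Hypotheses (hx : 0 < x) (hy : 0 < y).

Definition urn_step (h : R * R) (u : R) (vw : R * R) : R * R :=
  let delta : R := (u <= h.1 / (h.1 + h.2))%R%:R in
  (h.1 + quantile mu vw.1 * delta, h.2 + quantile nu vw.2 * (1 - delta)).

Local Notation state := (rru U VW mu nu x y).

Lemma rruS n w : state n.+1 w = urn_step (state n w) (U n w) (VW n w).
Proof. by rewrite /rru/= /urn_step; case: (urn _ _ _ _ _ n). Qed.

Lemma rru_gt0 n w : 0 < (state n w).1 /\ 0 < (state n w).2.
Proof.
elim: n => [|n [X0 Y0]]; first by split.
rewrite rruS /urn_step/=; split.
- by apply: ltr_wpDr => //; apply: mulr_ge0; [exact: (quantile_ge0 hmu)|exact: ler0n].
- rewrite ltr_wpDr// mulr_ge0// ?(quantile_ge0 hnu)// subr_ge0.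
  by rewrite lern1 leq_b1.
Qed.

Lemma rru_nondecreasing n k w : (n <= k)%N ->
  (state n w).1 <= (state k w).1 /\ (state n w).2 <= (state k w).2.
Proof.
move=> /subnK <-; elim: (k - n)%N => [|j [IH1 IH2]]; first by rewrite add0n.
rewrite addSn rruS.
split; [apply: (le_trans IH1)|apply: (le_trans IH2)]; rewrite /urn_step/= lerDl.
- by apply: mulr_ge0; [exact: (quantile_ge0 hmu)|exact: ler0n].
- rewrite mulr_ge0// ?(quantile_ge0 hnu)// subr_ge0.
  by rewrite lern1 leq_b1.
Qed.

(** This deterministic bound makes the weights [1/u] and [1/u^2] bounded at each fixed time, as
    dominated convergence requires. *)
Lemma rru_total_le n w :
  (state n w).1 + (state n w).2 <= x + y + beta *+ n.
Proof.
elim: n => [|n IHn]; first by rewrite addr0.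
rewrite rruS /urn_step/= mulrS.
have q1 := quantile_le_bound hbeta hmu (VW n w).1.
have q2 := quantile_le_bound hbeta hnu (VW n w).2.
by case: (U n w <= _); rewrite ?subrr ?subr0 ?mulr1 ?mulr0 ?addr0; lra.
Qed.

Lemma measurable_urn_step :
  measurable_fun setT (fun z : (R * R) * (R * (R * R)) => urn_step z.1 z.2.1 z.2.2).
Proof.
have mf1 : measurable_fun setT (fun z : (R * R) * (R * (R * R)) => z.1.1).
  exact: measurableT_comp.
have mf2 : measurable_fun setT (fun z : (R * R) * (R * (R * R)) => z.1.2).
  exact: measurableT_comp.
have mu1 : measurable_fun setT (fun z : (R * R) * (R * (R * R)) => z.2.1).
  exact: measurableT_comp.
have mv : measurable_fun setT (fun z : (R * R) * (R * (R * R)) => z.2.2.1).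
  by apply: measurableT_comp => //; exact: measurableT_comp.
have mw : measurable_fun setT (fun z : (R * R) * (R * (R * R)) => z.2.2.2).
  by apply: measurableT_comp => //; exact: measurableT_comp.
have md : measurable_fun setT (fun z : (R * R) * (R * (R * R)) =>
    (z.2.1 <= z.1.1 / (z.1.1 + z.1.2))%R%:R : R).
  rewrite (_ : (fun _ => _) = (fun z : (R * R) * (R * (R * R)) =>
     if z.2.1 <= z.1.1 / (z.1.1 + z.1.2) then 1 else 0 : R)); last first.
    by apply/funext => z; case: (z.2.1 <= _).
  apply: measurable_fun_ifT => //; apply: measurable_fun_ler => //.
  apply: measurable_funM => //.
  by apply: measurable_funV; exact: measurable_funD.
apply: measurable_fun_pair => /=.
- apply: measurable_funD => //; apply: measurable_funM => //.
  exact: measurableT_comp (measurable_quantile hbeta hmu) mv.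
- apply: measurable_funD => //; apply: measurable_funM => //.
    exact: measurableT_comp (measurable_quantile hbeta hnu) mw.
  exact: measurable_funB.
Qed.

Local Notation adapted := (adapted U VW).

Lemma adapted_rru n : adapted n (state n).
Proof.
elim: n => [|n IHn].
  apply/adaptedP; exact: measurable_cst.
apply/adaptedP.
rewrite (_ : state n.+1 = (fun z => urn_step z.1 z.2.1 z.2.2) \o
  (fun w => (state n w, (U n w, VW n w)))); last first.
  by apply/funext => w; rewrite rruS.
apply: (measurableT_comp measurable_urn_step).
apply: measurable_fun_pair.
  by apply/adaptedP; apply: adapted_mono IHn.
apply: measurable_fun_pair; apply/adaptedP => C mC; apply: sub_sigma_algebra.
- exact: past_preimageU.
- exact: past_preimageV.
Qed.

Lemma adapted_rru_pair n k : (n <= k)%N ->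
  adapted k (fun w => (state n w, state k w)).
Proof.
move=> nk; apply/adaptedP; apply: measurable_fun_pair.
  by apply/adaptedP; apply: (adapted_mono nk); exact: adapted_rru.
by apply/adaptedP; exact: adapted_rru.
Qed.

Lemma measurable_rru n : measurable_fun setT (state n).
Proof. exact: (adapted_measurable (@adapted_rru n)). Qed.

Section one_step.
Variables (F : (R * R) * (R * R) -> R).
Hypotheses (mF : measurable_fun setT F) (F0 : forall z, 0 <= F z).
Variables (n k : nat) (nk : (n <= k)%N).

(** [state n] rides along as a parameter so that weights on the past can be carried. The next [U]
    enters only through the color, chosen with the current proportions; the reinforcement is
    averaged separately by independence. *)
Lemma integral_rruS :
  (\int[P]_w (F (state n w, state k.+1 w))%:E =
   \int[P]_w
     (((state k w).1 / ((state k w).1 + (state k w).2))%:E *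
       \int[P]_w' (F (state n w, ((state k w).1 + quantile mu (VW k w').1, (state k w).2)))%:E
     + ((state k w).2 / ((state k w).1 + (state k w).2))%:E *
       \int[P]_w' (F (state n w, ((state k w).1, (state k w).2 + quantile nu (VW k w').2)))%:E))%E.
Proof.
pose f (h : (R * R) * (R * R)) (u : R) (v : R * R) :=
  (F (h.1, urn_step h.2 u v))%:E.
transitivity (\int[P]_w f (state n w, state k w) (U k w) (VW k w))%E.
  by apply: eq_integral => w _; rewrite rruS.
case: hdriving => -[iU _] U01 [iV _] V01 W01 iUV.
rewrite (integral_adapted iU iV iUV (H := fun w => (state n w, state k w)) (f := f)
  (@adapted_rru_pair _ _ nk)); last 2 first.
- apply/measurable_EFinP; apply: (measurableT_comp mF).
  apply: measurable_fun_pair; first exact: measurableT_comp.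
  apply: (measurableT_comp measurable_urn_step
    (g := fun z : ((R * R) * (R * R)) * (R * (R * R)) => (z.1.2, z.2))).
  by apply: measurable_fun_pair => //; exact: measurableT_comp.
- by move=> h u v; rewrite lee_fin.
apply: eq_integral => w _.
set X := (state k w).1; set Y := (state k w).2.
set A := (X in (_ * X + _)%E); set B := (X in (_ + _ * X)%E).
have [X0 Y0] := rru_gt0 k w.
have [A0 B0] : (0 <= A /\ 0 <= B)%E.
  by split; apply: integral_ge0 => w' _; rewrite lee_fin.
set D := [set w1 | U k w1 <= X / (X + Y)].
have z01 : 0 <= X / (X + Y) <= 1.
  apply/andP; split; first by rewrite divr_ge0 ?addr_ge0 ?ltW.
  by rewrite ler_pdivrMr ?addr_gt0// mul1r lerDl ltW.
have PD : P D = (X / (X + Y))%:E by exact: (uniform01_le (U01 k) z01).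
have mD : measurable D.
  rewrite (_ : D = U k @^-1` `]-oo, (X / (X + Y))]%classic); last first.
    by rewrite preimage_itvNyc.
  by rewrite -[X in measurable X]setTI; exact: measurable_funPT.
have PDc : P (~` D) = (Y / (X + Y))%:E.
  rewrite probability_setC// PD -EFinB; congr EFin.
  by field; rewrite gt_eqF// addr_gt0.
transitivity (\int[P]_w1 ((\1_D w1)%:E * A + (\1_(~` D) w1)%:E * B))%E.
  apply: eq_integral => w1 _.
  rewrite !indicE in_setC; have [Dw1|Dw1] := boolP (w1 \in D) => /=.
    rewrite mul1e mul0e adde0; apply: eq_integral => w2 _.
    by rewrite /f /urn_step/= (set_mem Dw1) mulr1 subrr mulr0 addr0.
  rewrite mul1e mul0e add0e; apply: eq_integral => w2 _.
  have -> : f (state n w, state k w) (U k w1) (VW k w2) =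
      (F (state n w, (X, Y + quantile nu (VW k w2).2)))%:E.
    rewrite /f /urn_step/=.
    have /negbTE -> : ~~ (U k w1 <= X / (X + Y)).
      by apply: contra Dw1 => h; rewrite inE.
    by rewrite mulr0 addr0 subr0 mulr1.
  by [].
rewrite ge0_integralD//; last 4 first.
- by move=> w1 _; rewrite mule_ge0.
- by apply: emeasurable_funM => //; apply/measurable_EFinP; exact: measurable_indic.
- by move=> w1 _; rewrite mule_ge0.
- apply: emeasurable_funM => //; apply/measurable_EFinP.
  by apply: measurable_indic; exact: measurableC.
rewrite !ge0_integralZr//. 
- congr (_ * _ + _ * _)%E.
    by rewrite integral_indic// setIT; exact: PD.
  by rewrite integral_indic ?setIT; [exact: PDc| |exact: measurableC].
- by apply/measurable_EFinP; apply: measurable_indic; exact: measurableC.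
- by apply/measurable_EFinP; exact: measurable_indic.
Qed.

Variable G : (R * R) * (R * R) -> R.
Hypotheses (mG : measurable_fun setT G) (G0 : forall z, 0 <= G z).

Let mXq w : measurable_fun setT (fun r => F (state n w, ((state k w).1 + r, (state k w).2))).
Proof.
apply: (measurableT_comp mF); apply: measurable_fun_pair => //.
by apply: measurable_fun_pair => //; exact: measurable_funD.
Qed.

Let mYq w : measurable_fun setT (fun r => F (state n w, ((state k w).1, (state k w).2 + r))).
Proof.
apply: (measurableT_comp mF); apply: measurable_fun_pair => //.
by apply: measurable_fun_pair => //; exact: measurable_funD.
Qed.

Let mV : measurable_fun setT (fun w => (VW k w).1).
Proof. exact: measurableT_comp. Qed.
Let mW : measurable_fun setT (fun w => (VW k w).2).
Proof. exact: measurableT_comp. Qed.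

Let mqV : measurable_fun setT (fun w => quantile mu (VW k w).1).
Proof. exact: measurableT_comp (measurable_quantile hbeta hmu) mV. Qed.
Let mqW : measurable_fun setT (fun w => quantile nu (VW k w).2).
Proof. exact: measurableT_comp (measurable_quantile hbeta hnu) mW. Qed.

Let EqV : (\int[P]_w (quantile mu (VW k w).1)%:E = m%:E)%E.
Proof.
rewrite (expectation_quantile hbeta hmu mV)//; exact: (V_uniform hdriving).
Qed.
Let EqW : (\int[P]_w (quantile nu (VW k w).2)%:E = m%:E)%E.
Proof.
rewrite (expectation_quantile hbeta hnu mW)//; exact: (W_uniform hdriving).
Qed.

Let qV0b w : 0 <= quantile mu (VW k w).1 <= beta.
Proof. by rewrite (quantile_ge0 hmu) (quantile_le_bound hbeta hmu). Qed.
Let qW0b w : 0 <= quantile nu (VW k w).2 <= beta.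
Proof. by rewrite (quantile_ge0 hnu) (quantile_le_bound hbeta hnu). Qed.

Let mstate (H : (R * R) * (R * R) -> R) : measurable_fun setT H ->
  measurable_fun setT (fun w => (H (state n w, state k w))%:E).
Proof.
move=> mH; apply/measurable_EFinP; apply: (measurableT_comp mH).
by apply: measurable_fun_pair; exact: measurable_rru.
Qed.

Let weightX w : 0 <= (state k w).1 / ((state k w).1 + (state k w).2).
Proof. by have [X0 Y0] := rru_gt0 k w; rewrite divr_ge0 ?addr_ge0 ?ltW. Qed.

Let weightY w : 0 <= (state k w).2 / ((state k w).1 + (state k w).2).
Proof. by have [X0 Y0] := rru_gt0 k w; rewrite divr_ge0 ?addr_ge0 ?ltW. Qed.

Let mrhs : measurable_fun setT (fun w =>
     (((state k w).1 / ((state k w).1 + (state k w).2))%:E *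
       \int[P]_w' (F (state n w, ((state k w).1 + quantile mu (VW k w').1, (state k w).2)))%:E
     + ((state k w).2 / ((state k w).1 + (state k w).2))%:E *
       \int[P]_w' (F (state n w, ((state k w).1, (state k w).2 + quantile nu (VW k w').2)))%:E)%E).
Proof.
have mS : measurable_fun setT (fun w => (state n w, state k w)).
  by apply: measurable_fun_pair; exact: measurable_rru.
have mX : measurable_fun setT (fun w => (state k w).1).
  by apply: measurableT_comp => //; exact: measurable_rru.
have mY : measurable_fun setT (fun w => (state k w).2).
  by apply: measurableT_comp => //; exact: measurable_rru.
have mVi : measurable_fun setT (fun w => ((state k w).1 + (state k w).2)^-1).
  by apply: measurable_funV; exact: measurable_funD.
pose fX (z : ((R * R) * (R * R)) * T) : \bar R :=
  (F (z.1.1, (z.1.2.1 + quantile mu (VW k z.2).1, z.1.2.2)))%:E.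
pose fY (z : ((R * R) * (R * R)) * T) : \bar R :=
  (F (z.1.1, (z.1.2.1, z.1.2.2 + quantile nu (VW k z.2).2)))%:E.
have m11 : measurable_fun setT (fun z : ((R * R) * (R * R)) * T => z.1.1).
  exact: measurableT_comp.
have m12 : measurable_fun setT (fun z : ((R * R) * (R * R)) * T => z.1.2).
  exact: measurableT_comp.
have mfX : measurable_fun setT fX.
  apply/measurable_EFinP; apply: (measurableT_comp mF).
  apply: measurable_fun_pair => //; apply: measurable_fun_pair.
    by apply: measurable_funD; [exact: measurableT_comp|exact: (measurableT_comp mqV)].
  exact: measurableT_comp.
have mfY : measurable_fun setT fY.
  apply/measurable_EFinP; apply: (measurableT_comp mF).
  apply: measurable_fun_pair => //; apply: measurable_fun_pair.
    exact: measurableT_comp.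
  by apply: measurable_funD; [exact: measurableT_comp|exact: (measurableT_comp mqW)].
apply: emeasurable_funD; apply: emeasurable_funM.
- by apply/measurable_EFinP; exact: measurable_funM.
- have h := @measurable_fun_fubini_tonelli_F _ _ _ T R P fX mfX
    (fun z => ltac:(by rewrite lee_fin)).
  exact: (measurableT_comp h mS).
- by apply/measurable_EFinP; exact: measurable_funM.
- have h := @measurable_fun_fubini_tonelli_F _ _ _ T R P fY mfY
    (fun z => ltac:(by rewrite lee_fin)).
  exact: (measurableT_comp h mS).
Qed.

(** The drift condition is asked only of states above the earlier state [a], the only ones that can
    follow it. *)
Lemma integral_rruS_ge :
  (forall (a : R * R) X Y, 0 < a.1 -> 0 < a.2 -> a.1 <= X -> a.2 <= Y ->
    exists A0 A1 B0 B1, [/\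
      forall r, 0 <= r <= beta -> A0 + A1 * r <= F (a, (X + r, Y)),
      forall r, 0 <= r <= beta -> B0 + B1 * r <= F (a, (X, Y + r)) &
      G (a, (X, Y)) <= X / (X + Y) * (A0 + A1 * m) + Y / (X + Y) * (B0 + B1 * m)]) ->
  (\int[P]_w (G (state n w, state k w))%:E <=
   \int[P]_w (F (state n w, state k.+1 w))%:E)%E.
Proof.
move=> FG; rewrite integral_rruS; apply: ge0_le_integral => //.
- by move=> w _; rewrite lee_fin.
- exact: mstate.
move=> w _; have [a1 a2] := rru_gt0 n w.
have [aX aY] := rru_nondecreasing w nk.
have [A0 [A1 [B0 [B1 [hA hB hG]]]]] := FG _ _ _ a1 a2 aX aY.
rewrite [X in G (_, X)]surjective_pairing.
move: hG; rewrite -lee_fin => /le_trans; apply.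
rewrite EFinD; apply: leeD; rewrite EFinM; apply: lee_wpmul2l; rewrite ?lee_fin//.
- exact: (affine_minorant_expectation mqV qV0b EqV (mXq w)).
- exact: (affine_minorant_expectation mqW qW0b EqW (mYq w)).
Qed.

Lemma integral_rruS_le :
  (forall (a : R * R) X Y, 0 < a.1 -> 0 < a.2 -> a.1 <= X -> a.2 <= Y ->
    exists A0 A1 B0 B1, [/\
      forall r, 0 <= r <= beta -> F (a, (X + r, Y)) <= A0 + A1 * r,
      forall r, 0 <= r <= beta -> F (a, (X, Y + r)) <= B0 + B1 * r &
      X / (X + Y) * (A0 + A1 * m) + Y / (X + Y) * (B0 + B1 * m) <= G (a, (X, Y))]) ->
  (\int[P]_w (F (state n w, state k.+1 w))%:E <=
   \int[P]_w (G (state n w, state k w))%:E)%E.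
Proof.
move=> FG; rewrite integral_rruS; apply: ge0_le_integral => //.
- move=> w _; apply: adde_ge0; apply: mule_ge0; rewrite ?lee_fin//;
  by apply: integral_ge0 => w' _; rewrite lee_fin.
- exact: mstate.
move=> w _; have [a1 a2] := rru_gt0 n w.
have [aX aY] := rru_nondecreasing w nk.
have [A0 [A1 [B0 [B1 [hA hB hG]]]]] := FG _ _ _ a1 a2 aX aY.
rewrite [X in G (_, X)]surjective_pairing.
move: hG; rewrite -lee_fin; apply: le_trans.
rewrite EFinD; apply: leeD; rewrite [leRHS]EFinM; apply: lee_wpmul2l; rewrite ?lee_fin//.
- exact: (affine_majorant_expectation mqV qV0b EqV (mXq w)).
- exact: (affine_majorant_expectation mqW qW0b EqW (mYq w)).
Qed.

End one_step.

(** * Comparison of successive times under a weight on the past *)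

Section weighted_comparison.
Variables (h f g : R * R -> R) (sbar : R).
Hypotheses (mh : measurable_fun setT h) (h0 : forall a, 0 <= h a)
  (mf : measurable_fun setT f) (mg : measurable_fun setT g).
Hypothesis h_support : forall a : R * R, 0 < a.1 -> 0 < a.2 -> h a != 0 -> inv_total a <= sbar.
Hypothesis f0 : forall X Y : R, 0 < X -> 0 < Y -> inv_total (X, Y) <= sbar -> 0 <= f (X, Y).
Hypothesis g0 : forall X Y : R, 0 < X -> 0 < Y -> inv_total (X, Y) <= sbar -> 0 <= g (X, Y).

(* The truncation at 0 only affects states that the urn does not reach. *)
Let F (z : (R * R) * (R * R)) := h z.1 * Num.max 0 (f z.2).
Let G (z : (R * R) * (R * R)) := h z.1 * Num.max 0 (g z.2).

Let mtrunc (u : R * R -> R) : measurable_fun setT u ->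
  measurable_fun setT (fun z : (R * R) * (R * R) => h z.1 * Num.max 0 (u z.2)).
Proof.
move=> mu'; apply: measurable_funM; first exact: measurableT_comp.
by apply: (measurable_maxr (f := cst 0)) => //; exact: measurableT_comp.
Qed.

Let F0 z : 0 <= F z. Proof. by rewrite mulr_ge0// le_max lexx. Qed.
Let G0 z : 0 <= G z. Proof. by rewrite mulr_ge0// le_max lexx. Qed.

Let inv_total_le (a b : R * R) : 0 < a.1 -> 0 < a.2 -> a.1 <= b.1 -> a.2 <= b.2 ->
  inv_total b <= inv_total a.
Proof.
move=> a1 a2 ab1 ab2; rewrite lef_pV2 ?lerD// posrE addr_gt0//.
- exact: lt_le_trans ab1.
- exact: lt_le_trans ab2.
Qed.

Let truncE (u : R * R -> R) n k w : (n <= k)%N ->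
  (forall X Y : R, 0 < X -> 0 < Y -> inv_total (X, Y) <= sbar -> 0 <= u (X, Y)) ->
  h (state n w) * Num.max 0 (u (state k w)) = h (state n w) * u (state k w).
Proof.
move=> nk u0; have [->|hn0] := eqVneq (h (state n w)) 0; first by rewrite !mul0r.
have [a1 a2] := rru_gt0 n w; have [b1 b2] := rru_gt0 k w.
have [ab1 ab2] := rru_nondecreasing w nk.
rewrite max_r// (surjective_pairing (state k w)) u0//.
rewrite -surjective_pairing; apply: le_trans (h_support a1 a2 hn0).
exact: inv_total_le.
Qed.

Lemma weighted_integral_ge n k : (n <= k)%N ->
  (forall X Y : R, 0 < X -> 0 < Y -> inv_total (X, Y) <= sbar ->
    exists A0 A1 B0 B1, [/\
      forall r, 0 <= r <= beta -> A0 + A1 * r <= f (X + r, Y),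
      forall r, 0 <= r <= beta -> B0 + B1 * r <= f (X, Y + r) &
      g (X, Y) <= X / (X + Y) * (A0 + A1 * m) + Y / (X + Y) * (B0 + B1 * m)]) ->
  (\int[P]_w (h (state n w) * g (state k w))%:E <=
   \int[P]_w (h (state n w) * f (state k.+1 w))%:E)%E.
Proof.
move=> nk fg.
under [leLHS]eq_integral do rewrite -(truncE _ nk g0).
under [leRHS]eq_integral do rewrite -(truncE _ (leqW nk) f0).
apply: (@integral_rruS_ge F (mtrunc mf) F0 n k nk G (mtrunc mg) G0) => a X Y a1 a2 aX aY.
rewrite /F /G /=.
(* Where the weight vanishes there is nothing to prove; elsewhere [inv_total a <= sbar], and this
   persists because the contents only grow. *)
have [->|ha0] := eqVneq (h a) 0.
  by exists 0, 0, 0, 0; split => *; rewrite !mul0r ?addr0 ?mulr0.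
have X0 := lt_le_trans a1 aX; have Y0 := lt_le_trans a2 aY.
have XYs : inv_total (X, Y) <= sbar.
  by apply: le_trans (h_support a1 a2 ha0); exact: inv_total_le.
have [A0 [A1 [B0 [B1 [hA hB hG]]]]] := fg _ _ X0 Y0 XYs.
exists (h a * A0), (h a * A1), (h a * B0), (h a * B1); split.
- move=> r rb; rewrite -mulrA -mulrDr ler_wpM2l// (le_trans (hA r rb))//.
  by rewrite le_max lexx orbT.
- move=> r rb; rewrite -mulrA -mulrDr ler_wpM2l// (le_trans (hB r rb))//.
  by rewrite le_max lexx orbT.
- rewrite max_r ?g0//.
  have -> : X / (X + Y) * (h a * A0 + h a * A1 * m) + Y / (X + Y) * (h a * B0 + h a * B1 * m)
    = h a * (X / (X + Y) * (A0 + A1 * m) + Y / (X + Y) * (B0 + B1 * m)) by ring.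
  by rewrite ler_wpM2l.
Qed.

Lemma weighted_integral_le n k : (n <= k)%N ->
  (forall X Y : R, 0 < X -> 0 < Y -> inv_total (X, Y) <= sbar ->
    exists A0 A1 B0 B1, [/\
      forall r, 0 <= r <= beta -> f (X + r, Y) <= A0 + A1 * r,
      forall r, 0 <= r <= beta -> f (X, Y + r) <= B0 + B1 * r &
      X / (X + Y) * (A0 + A1 * m) + Y / (X + Y) * (B0 + B1 * m) <= g (X, Y)]) ->
  (\int[P]_w (h (state n w) * f (state k.+1 w))%:E <=
   \int[P]_w (h (state n w) * g (state k w))%:E)%E.
Proof.
move=> nk fg.
under [leRHS]eq_integral do rewrite -(truncE _ nk g0).
under [leLHS]eq_integral do rewrite -(truncE _ (leqW nk) f0).
apply: (@integral_rruS_le F (mtrunc mf) F0 n k nk G (mtrunc mg)) => a X Y a1 a2 aX aY.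
rewrite /F /G /=.
have [->|ha0] := eqVneq (h a) 0.
  by exists 0, 0, 0, 0; split => *; rewrite !mul0r ?addr0 ?mulr0 ?addr0.
have X0 := lt_le_trans a1 aX; have Y0 := lt_le_trans a2 aY.
have inv_le X' Y' : X <= X' -> Y <= Y' -> inv_total (X', Y') <= sbar.
  move=> XX' YY'; apply: le_trans (h_support a1 a2 ha0); apply: inv_total_le => //=.
  - exact: le_trans XX'.
  - exact: le_trans YY'.
have [A0 [A1 [B0 [B1 [hA hB hG]]]]] := fg _ _ X0 Y0 (inv_le _ _ (lexx X) (lexx Y)).
exists (h a * A0), (h a * A1), (h a * B0), (h a * B1); split.
- move=> r /andP[r0 rb]; rewrite -mulrA -mulrDr ler_wpM2l// max_r ?hA ?r0//.
  by rewrite f0 ?ltr_wpDr// inv_le// lerDl.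
- move=> r /andP[r0 rb]; rewrite -mulrA -mulrDr ler_wpM2l// max_r ?hB ?r0//.
  by rewrite f0 ?ltr_wpDr// inv_le// lerDl.
- rewrite max_r ?g0 ?inv_le//.
  have -> : X / (X + Y) * (h a * A0 + h a * A1 * m) + Y / (X + Y) * (h a * B0 + h a * B1 * m)
    = h a * (X / (X + Y) * (A0 + A1 * m) + Y / (X + Y) * (B0 + B1 * m)) by ring.
  by rewrite ler_wpM2l.
Qed.

End weighted_comparison.

End urn_process.

(** * Long-run behaviour *)

Lemma measurable_log_potential {R : realType} (beta : R) :
  measurable_fun setT (log_potential beta).
Proof.
apply: measurable_funD.
  apply: (measurableT_comp (@measurable_ln R)); apply: measurable_funM.
    exact: measurable_funD.
  exact: measurable_funV.
by apply: measurable_funM => //; exact: measurable_funV.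
Qed.

Section long_run.
Context {R : realType} d {T : measurableType d} (P : probability T R).
Variables (U : nat -> {RV P >-> R}) (VW : nat -> {RV P >-> (R * R)%type}).
Hypothesis hdriving : rru_driving U VW.
Variables (beta : R) (mu nu : probability (measurableTypeR R) R).
Hypotheses (hbeta : 0 < beta) (hmu : mu `[0, beta]%classic = 1%E)
  (hnu : nu `[0, beta]%classic = 1%E).
Variables (m x y : R).
Hypotheses (hm : 0 < m) (hmean_mu : mean mu = m%:E) (hmean_nu : mean nu = m%:E).
Hypotheses (hx : 0 < x) (hy : 0 < y).

Local Notation state := (rru U VW mu nu x y).

(** Ensures that the contraction factor [rho] is nonnegative. *)
Lemma mean_le_bound : m <= beta.
Proof.
have mV : measurable_fun setT (fun w => (VW 0%N w).1) by exact: measurableT_comp.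
rewrite -lee_fin -hmean_mu -(expectation_quantile hbeta hmu mV (V_uniform hdriving 0%N)).
have -> : beta%:E = (\int[P]_w beta%:E)%E.
  by rewrite integral_cst//= probability_setT mule1.
apply: ge0_le_integral => //.
- by move=> w _; rewrite lee_fin (quantile_ge0 hmu).
- apply/measurable_EFinP.
  exact: (measurableT_comp (measurable_quantile hbeta hmu) mV).
- by move=> w _; rewrite lee_fin (quantile_le_bound hbeta hmu).
Qed.

Let rho := 1 - m / (1 + beta).

Let rho0 : 0 <= rho.
Proof.
rewrite subr_ge0 ler_pdivrMr ?(addr_gt0 ltr01 hbeta)// mul1r.
by rewrite (le_trans mean_le_bound)// lerDr.
Qed.

Let rho1 : rho < 1.
Proof. by rewrite gtrBl divr_gt0// addr_gt0. Qed.

Let mexp : measurable_fun setT (fun b : R * R => expR (- (b.1 + b.2))).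
Proof.
apply: (measurableT_comp (@measurable_expR R)).
by apply: measurable_funN; exact: measurable_funD.
Qed.

Lemma integral_exp_total n :
  (\int[P]_w (expR (- ((state n w).1 + (state n w).2)))%:E <=
   (rho ^+ n * expR (- (x + y)))%:E)%E.
Proof.
elim: n => [|n IHn].
  under eq_integral do rewrite /=.
  by rewrite integral_cst//= probability_setT mule1 expr0 mul1r.
apply: (@le_trans _ _ (\int[P]_w (rho * expR (- ((state n w).1 + (state n w).2)))%:E)%E).
  apply: (@integral_rruS_le _ _ _ _ _ _ hdriving _ _ _ hbeta hmu hnu _ _ _
    hmean_mu hmean_nu hx hy (fun z => expR (- (z.2.1 + z.2.2))) _ _ n n (leqnn n)
    (fun z => rho * expR (- (z.2.1 + z.2.2)))).
  - exact: (measurableT_comp mexp).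
  - by move=> z; exact: expR_ge0.
  - by apply: measurable_funM => //; exact: (measurableT_comp mexp).
  - move=> a X Y a1 a2 aX aY.
    have X0 := lt_le_trans a1 aX; have Y0 := lt_le_trans a2 aY.
    exact: exponential_drift.
under eq_integral do rewrite EFinM.
rewrite ge0_integralZl//.
- by rewrite exprS -mulrA EFinM lee_wpmul2l// lee_fin.
apply/measurable_EFinP; apply: (measurableT_comp mexp).
exact: (measurable_rru U VW hbeta hmu hnu x y).
Qed.

(** On [N j] the total stays below [j], so [exp (-S_k) >= exp (-j)] for every [k], whereas the mean
    of [exp (-S_k)] is at most a constant times [rho^k]. *)
Lemma ae_total_unbounded :
  {ae P, forall w, forall j : nat, exists k, j%:R < (state k w).1 + (state k w).2}.
Proof.
pose N j := \bigcap_k [set w | (state k w).1 + (state k w).2 <= j%:R].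
have mS k : measurable_fun setT (state k).
  exact: (measurable_rru U VW hbeta hmu hnu x y).
have mN j : measurable (N j).
  apply: bigcapT_measurable => k.
  have mSk : measurable_fun setT (fun w => (state k w).1 + (state k w).2).
    by apply: measurable_funD; exact: measurableT_comp.
  rewrite (_ : [set w | _] = (fun w => (state k w).1 + (state k w).2) @^-1`
     `]-oo, j%:R]%classic); last by rewrite preimage_itvNyc.
  by rewrite -[X in measurable X]setTI; exact: mSk.
have N0 j : P (N j) = 0%E.
  have le k : ((expR (- j%:R))%:E * P (N j) <= (rho ^+ k * expR (- (x + y)))%:E)%E.
    apply: le_trans (integral_exp_total k).
    have -> : ((expR (- j%:R))%:E * P (N j) = \int[P]_(w in N j) (expR (- j%:R))%:E)%E.
      by rewrite integral_cst.
    apply: (@le_trans _ _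
      (\int[P]_(w in N j) (expR (- ((state k w).1 + (state k w).2)))%:E)%E).
      apply: ge0_le_integral => //.
      - by apply/measurable_EFinP/measurable_funTS; exact: (measurableT_comp mexp (mS k)).
      - by move=> w /(_ k I) /= Nw; rewrite lee_fin ler_expR lerN2.
    apply: ge0_subset_integral => //.
    by apply/measurable_EFinP; exact: (measurableT_comp mexp (mS k)).
  have Pfin : P (N j) \is a fin_num by rewrite fin_num_measure.
  have q0 : 0 <= fine (P (N j)) by rewrite fine_ge0.
  have le0 : expR (- j%:R) * fine (P (N j)) <= 0.
    have hc := cvg_geometric (expR (- (x + y))) (z := rho) _.
    rewrite -(cvg_lim _ (hc _))//; last by rewrite ger0_norm.
    apply: limr_ge; first by apply/cvg_ex; exists 0; apply: hc; rewrite ger0_norm.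
    apply: nearW => k; rewrite /geometric/= mulrC -lee_fin.
    by rewrite [in leRHS]mulrC EFinM muleC fineK.
  rewrite -[LHS]fineK//; congr EFin; apply/eqP; rewrite eq_le q0 andbT.
  by rewrite -(pmulr_rle0 _ (expR_gt0 (- j%:R))) le0.
have NN : P.-negligible (\bigcup_j N j).
  by apply: negligible_bigcup => j; exists (N j); split; [exact: mN|exact: N0|].
case: NN => A [mA A0 NA]; exists A; split=> //; apply: subset_trans NA => w /= nw.
apply: contrapT => nN; apply: nw => j; apply: contrapT => nk; apply: nN.
exists j => // k _ /=; rewrite leNgt; apply/negP => jk.
by apply: nk; exists k.
Qed.

Lemma ae_inv_total_cvg0 :
  {ae P, forall w, inv_total (state n w) @[n --> \oo] --> (0 : R)}.
Proof.
apply: filterS ae_total_unbounded => w hw.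
apply/cvgrPdist_lt => e e0.
have [k hk] := hw (Num.bound e^-1).
exists k => // n /= kn.
have [a1 a2] := rru_gt0 U VW hmu hnu hx hy n w.
have [X0 Y0] := rru_gt0 U VW hmu hnu hx hy k w.
have [XX YY] := rru_nondecreasing U VW hmu hnu x y w kn.
have S0 : 0 < inv_total (state n w) by rewrite invr_gt0 addr_gt0.
rewrite sub0r normrN gtr0_norm// -[ltRHS]invrK ltf_pV2 ?posrE ?invr_gt0 ?addr_gt0//.
apply: lt_le_trans (lerD XX YY); apply: lt_trans hk.
by rewrite archi_boundP// invr_ge0 ltW.
Qed.

(** [s] stands for the identity or the exchange of the colors, so that one induction serves both
    endpoints. *)
Let integral_log_potential_aux (s : R * R -> R * R) n :
  measurable_fun setT s ->
  (forall X Y : R, 0 < X -> 0 < Y -> 0 <= log_potential beta (s (X, Y))) ->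
  (forall X Y : R, 0 < X -> 0 < Y ->
    exists A0 A1 B0 B1, [/\
      forall r, 0 <= r <= beta -> log_potential beta (s (X + r, Y)) <= A0 + A1 * r,
      forall r, 0 <= r <= beta -> log_potential beta (s (X, Y + r)) <= B0 + B1 * r &
      X / (X + Y) * (A0 + A1 * m) + Y / (X + Y) * (B0 + B1 * m) <=
        log_potential beta (s (X, Y))]) ->
  (\int[P]_w (log_potential beta (s (state n w)))%:E <=
    (log_potential beta (s (x, y)))%:E)%E.
Proof.
move=> ms s0 hs.
pose f b := Num.max 0 (log_potential beta (s b)).
have fE k w : f (state k w) = log_potential beta (s (state k w)).
  have [X0 Y0] := rru_gt0 U VW hmu hnu hx hy k w.
  by rewrite /f max_r// (surjective_pairing (state k w)) s0.
have mf : measurable_fun setT f.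
  apply: (measurable_maxr (f := cst 0)) => //.
  exact: (measurableT_comp (measurable_log_potential beta) ms).
under eq_integral do rewrite -fE.
elim: n => [|n IHn].
  rewrite (eq_integral (cst (log_potential beta (s (x, y)))%:E)).
    by rewrite integral_cst//= probability_setT mule1.
  by move=> w _; rewrite fE.
apply: (le_trans _ IHn).
apply: (@integral_rruS_le _ _ _ _ _ _ hdriving _ _ _ hbeta hmu hnu _ _ _
    hmean_mu hmean_nu hx hy (fun z => f z.2) _ _ n n (leqnn n) (fun z => f z.2)).
- exact: (measurableT_comp mf).
- by move=> z; rewrite le_max lexx.
- exact: (measurableT_comp mf).
- move=> a X Y a1 a2 aX aY.
  have X0 := lt_le_trans a1 aX; have Y0 := lt_le_trans a2 aY.
  have [A0 [A1 [B0 [B1 [hA hB hG]]]]] := hs _ _ X0 Y0.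
  exists A0, A1, B0, B1; split.
  + by move=> r /andP[r0 rb]; rewrite /f max_r ?hA ?r0// s0// ltr_wpDr.
  + by move=> r /andP[r0 rb]; rewrite /f max_r ?hB ?r0// s0// ltr_wpDr.
  + by rewrite /f max_r ?s0.
Qed.

Lemma integral_log_potential n :
  (\int[P]_w (log_potential beta (state n w))%:E <= (log_potential beta (x, y))%:E)%E.
Proof.
apply: (integral_log_potential_aux (s := id)) => //.
- by move=> X Y X0 Y0; exact: log_potential_ge0.
- by move=> X Y X0 Y0; exact: log_potential_drift.
Qed.

Lemma integral_log_potential_swap n :
  (\int[P]_w (log_potential beta ((state n w).2, (state n w).1))%:E <=
   (log_potential beta (y, x))%:E)%E.
Proof.
apply: (integral_log_potential_aux (s := fun b => (b.2, b.1))) => //.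
- exact: measurable_fun_pair.
- by move=> X Y X0 Y0; exact: log_potential_ge0.
- move=> X Y X0 Y0; have [A0 [A1 [B0 [B1 [hA hB hG]]]]] := log_potential_drift beta m Y0 X0.
  by exists B0, B1, A0, A1; split => //; rewrite addrC [X + Y]addrC.
Qed.

End long_run.

(** * Absence of point masses *)

Section no_point_mass.
Context {R : realType} d {T : measurableType d} (P : probability T R).
Variables (U : nat -> {RV P >-> R}) (VW : nat -> {RV P >-> (R * R)%type}).
Hypothesis hdriving : rru_driving U VW.
Variables (beta : R) (mu nu : probability (measurableTypeR R) R).
Hypotheses (hbeta : 0 < beta) (hmu : mu `[0, beta]%classic = 1%E)
  (hnu : nu `[0, beta]%classic = 1%E).
Variables (m x y : R).
Hypotheses (hm : 0 < m) (hmean_mu : mean mu = m%:E) (hmean_nu : mean nu = m%:E).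
Hypotheses (hx : 0 < x) (hy : 0 < y).

Local Notation state := (rru U VW mu nu x y).

Variable Zinf : {RV P >-> R}.
Hypothesis hZinf : {ae P, forall w, proportion (state n w) @[n --> \oo] --> Zinf w}.

Let mstate n : measurable_fun setT (state n).
Proof. exact: (measurable_rru U VW hbeta hmu hnu x y). Qed.

Let mZ : measurable_fun setT Zinf. Proof. exact: measurable_funPT. Qed.

Lemma probability_le_tent p e : 0 < e ->
  (P [set w | Zinf w = p] <= \int[P]_w (tent e (Zinf w - p))%:E)%E.
Proof.
move=> e0.
have mA : measurable [set w | Zinf w = p].
  by have := mZ measurableT (measurable_set1 p); rewrite setTI.
have <- : (\int[P]_w (\1_[set w | Zinf w = p] w)%:E = P [set w | Zinf w = p])%E.
  by rewrite integral_indic// setIT.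
apply: ge0_le_integral => //.
- by apply/measurable_EFinP; exact: measurable_indic.
- apply/measurable_EFinP; apply: (measurableT_comp (measurable_tent e)).
  exact: measurable_funB.
- move=> w _; rewrite lee_fin indicE; have [wA|_] := boolP (w \in _); last exact: tent_ge0.
  by rewrite (set_mem wA) subrr tent0.
Qed.

Let cvg_tent e p : {ae P, forall w,
  tent e (proportion (state n w) - p) @[n --> \oo] --> tent e (Zinf w - p)}.
Proof.
apply: filterS hZinf => w hw; apply: continuous_cvg; first exact: continuous_tent.
by apply: cvgB; [exact: hw|exact: cvg_cst].
Qed.

(** Within [exp (-N)] of [p] the potential is at least [N]. So [N] times the tent of that width,
    evaluated at time [n], has mean at most [C]; letting [n] grow gives [N * P (Zinf = p) <= C] for
    every [N]. *)
Lemma no_point_mass_of_potential (p C : R) (psi : R * R -> R) :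
  (forall X Y, 0 < X -> 0 < Y -> 0 <= psi (X, Y)) ->
  measurable_fun setT psi ->
  (forall n, (\int[P]_w (psi (state n w))%:E <= C%:E)%E) ->
  (forall (N : nat) X Y, 0 < X -> 0 < Y ->
    `|proportion (X, Y) - p| <= expR (- N%:R) -> N%:R <= psi (X, Y)) ->
  P [set w | Zinf w = p] = 0%E.
Proof.
move=> psi0 mpsi psiC psiN; set A := [set w | _].
have mA : measurable A.
  by have := mZ measurableT (measurable_set1 p); rewrite setTI.
have key (N : nat) : (N%:R%:E * P A <= C%:E)%E.
  pose e := expR (- N%:R) : R.
  have e0 : 0 < e by exact: expR_gt0.
  apply: (@le_trans _ _ (\int[P]_w (N%:R * tent e (Zinf w - p))%:E)%E).
    under eq_integral do rewrite EFinM.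
    rewrite ge0_integralZl ?lee_fin//; last 2 first.
    - apply/measurable_EFinP; apply: (measurableT_comp (measurable_tent e)).
      exact: measurable_funB.
    - by move=> w _; rewrite lee_fin tent_ge0.
    by apply: lee_wpmul2l; [rewrite lee_fin|exact: probability_le_tent].
  have hc : (\int[P]_w (N%:R * tent e (proportion (state n w) - p))%:E)%E @[n --> \oo] -->
      (\int[P]_w (N%:R * tent e (Zinf w - p))%:E)%E.
    apply: (@bounded_cvg_integral _ _ _ P _ _ N%:R).
    - move=> n; apply: measurable_funM => //.
      apply: (measurableT_comp (measurable_tent e)); apply: measurable_funB => //.
      exact: (measurableT_comp measurable_proportion).
    - apply: measurable_funM => //.
      by apply: (measurableT_comp (measurable_tent e)); exact: measurable_funB.
    - move=> n w; rewrite ger0_norm ?mulr_ge0 ?tent_ge0//.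
      by rewrite -[leRHS]mulr1 ler_wpM2l// tent_le1.
    - apply: filterS (cvg_tent e p) => w hw.
      by apply: cvgM => //; exact: cvg_cst.
  rewrite -(cvg_lim _ hc)//; apply: lime_le; first by apply/cvg_ex; eexists; exact: hc.
  apply: nearW => n; apply: le_trans (psiC n).
  apply: ge0_le_integral => //.
  - by move=> w _; rewrite lee_fin mulr_ge0 ?tent_ge0.
  - apply/measurable_EFinP; apply: measurable_funM => //.
    apply: (measurableT_comp (measurable_tent e)); apply: measurable_funB => //.
    exact: (measurableT_comp measurable_proportion).
  - by apply/measurable_EFinP; exact: (measurableT_comp mpsi).
  - move=> w _; rewrite lee_fin.
    have [X0 Y0] := rru_gt0 U VW hmu hnu hx hy n w.
    rewrite [in leRHS](surjective_pairing (state n w)).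
    have [->|t0] := eqVneq (tent e (proportion (state n w) - p)) 0.
      by rewrite mulr0 psi0.
    apply: (@le_trans _ _ N%:R).
      by rewrite -[leRHS]mulr1 ler_wpM2l// tent_le1.
    apply: psiN => //; rewrite -surjective_pairing.
    exact: ltW (tent_neq0 e0 t0).
have Pfin : P A \is a fin_num by rewrite fin_num_measure.
rewrite -[LHS]fineK//; congr EFin; apply/eqP; rewrite eq_le fine_ge0// andbT.
rewrite leNgt; apply/negP => q0.
have := key (Num.bound (C / fine (P A))).
rewrite -[P A]fineK// -EFinM lee_fin leNgt => /negP; apply.
rewrite -ltr_pdivrMr//.
have [C0|C0] := leP 0 C; first by rewrite archi_boundP// divr_ge0// ltW.
by rewrite (@lt_le_trans _ _ 0)// ltr_pdivrMr// mul0r.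
Qed.

Lemma no_point_mass0 : P [set w | Zinf w = 0] = 0%E.
Proof.
apply: (@no_point_mass_of_potential 0 (log_potential beta (x, y)) (log_potential beta)).
- by move=> X Y X0 Y0; exact: log_potential_ge0.
- exact: measurable_log_potential.
- exact: (integral_log_potential hdriving hbeta hmu hnu hmean_mu hmean_nu hx hy).
- move=> N X Y X0 Y0; rewrite subr0 => h; apply: log_potential_ge => //.
  exact: le_trans (ler_norm _) h.
Qed.

Lemma no_point_mass1 : P [set w | Zinf w = 1] = 0%E.
Proof.
apply: (@no_point_mass_of_potential 1 (log_potential beta (y, x))
  (fun b => log_potential beta (b.2, b.1))).
- by move=> X Y X0 Y0; exact: log_potential_ge0.
- by apply: (measurableT_comp (measurable_log_potential beta)); exact: measurable_fun_pair.
- exact: (integral_log_potential_swap hdriving hbeta hmu hnu hmean_mu hmean_nu hx hy).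
- move=> N X Y X0 Y0 h; apply: log_potential_ge => //=.
  apply: le_trans h; rewrite distrC.
  have -> : 1 - proportion (X, Y) = Y / (Y + X).
    by rewrite /proportion/=; field; rewrite !gt_eqF ?addr_gt0.
  exact: ler_norm.
Qed.

(** The weight is frozen at time [n] while [k] tends to infinity. Domination uses that the total
    stays above [x + y]. *)
Lemma weighted_integral_cvg (h f : R * R -> R) (phi : R -> R) (n : nat) (B M : R) :
  measurable_fun setT h -> measurable_fun setT f -> measurable_fun setT phi ->
  0 <= B -> (forall w, `|h (state n w)| <= B) ->
  (forall X Y, 0 < X -> 0 < Y -> inv_total (X, Y) <= (x + y)^-1 -> `|f (X, Y)| <= M) ->
  (forall w, proportion (state k w) @[k --> \oo] --> Zinf w ->
     inv_total (state k w) @[k --> \oo] --> (0 : R) ->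
     f (state k w) @[k --> \oo] --> phi (Zinf w)) ->
  (\int[P]_w (h (state n w) * f (state k w))%:E)%E @[k --> \oo] -->
  (\int[P]_w (h (state n w) * phi (Zinf w))%:E)%E.
Proof.
move=> mh mf mphi B0 hB fM fphi.
apply: (@bounded_cvg_integral _ _ _ P _ _ (B * M)).
- move=> k; apply: measurable_funM; first exact: (measurableT_comp mh).
  exact: (measurableT_comp mf).
- apply: measurable_funM; first exact: (measurableT_comp mh).
  exact: (measurableT_comp mphi).
- move=> k w; rewrite normrM ler_pM//.
  have [X0 Y0] := rru_gt0 U VW hmu hnu hx hy k w.
  have [XX YY] := rru_nondecreasing U VW hmu hnu x y w (leq0n k).
  rewrite (surjective_pairing (state k w)) fM// lef_pV2 ?posrE ?addr_gt0//.
  exact: lerD.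
- have h0 := ae_inv_total_cvg0 hdriving hbeta hmu hnu hm hmean_mu hmean_nu hx hy.
  apply: filterS2 hZinf h0 => w h1 h2.
  by apply: cvgM; [exact: cvg_cst|exact: fphi].
Qed.

(** * Interior points *)

Section interior.
Variable p : R.
Hypothesis p01 : 0 < p < 1.

(** Variables tied by equations keep the constants opaque. The denominator of [sbar] is a sum of
    nonnegative terms, so [sbar] meets three thresholds at once: the two of [second_moment_drift],
    and [K s <= 1/2], which leaves half of [D^2] in the lower bound on [L]. *)
Variables (c K a e sbar : R).
Hypotheses (cE : c = m * (p * (1 - p)) / 8)
  (KE : K = (m / 2 + beta) ^+ 2 / (m * (p * (1 - p))))
  (aE : a = 12 * beta) (eE : e = 100 * beta ^+ 2)
  (sbarE : sbar = (4 * beta + 48 * K * beta / (m * (p * (1 - p))) + 2 * K)^-1).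
Let c0 := Num.min 2^-1 c.
Let C := 1 + a + e.

Let pv0 : 0 < m * (p * (1 - p)).
Proof. by case/andP: p01 => p0 p1; rewrite !mulr_gt0// subr_gt0. Qed.
Let c_gt0 : 0 < c. Proof. by rewrite cE divr_gt0. Qed.
Let K0 : 0 <= K. Proof. by rewrite KE divr_ge0 ?sqr_ge0 ?(ltW pv0). Qed.
Let a0 : 0 <= a. Proof. by rewrite aE mulr_ge0// ltW. Qed.
Let e0 : 0 <= e. Proof. by rewrite eE mulr_ge0// sqr_ge0. Qed.
Let c00 : 0 < c0. Proof. by rewrite lt_min c_gt0 invr_gt0 ltr0n. Qed.
Let C0 : 0 < C. Proof. by rewrite /C -addrA ltr_wpDr// addr_ge0. Qed.

Let den0 : 0 < 4 * beta + 48 * K * beta / (m * (p * (1 - p))) + 2 * K.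
Proof.
have b4 : 0 < 4 * beta by rewrite mulr_gt0.
have h1 : 0 <= 48 * K * beta / (m * (p * (1 - p))).
  by apply: divr_ge0; [rewrite !mulr_ge0// ltW|exact: ltW].
by rewrite ltr_wpDr ?mulr_ge0// ltr_wpDr.
Qed.
Let sbar0 : 0 < sbar. Proof. by rewrite sbarE invr_gt0. Qed.

Let sbar_small s : 0 <= s -> s <= sbar ->
  [/\ beta * s <= 4^-1, 6 * K * beta * s <= m * (p * (1 - p)) / 8 & K * s <= 2^-1].
Proof.
move=> s0 ss.
have : s * (4 * beta + 48 * K * beta / (m * (p * (1 - p))) + 2 * K) <= 1.
  by rewrite -ler_pdivlMr// mul1r -sbarE.
have h1 : 0 <= s * (4 * beta) by rewrite !mulr_ge0// ltW.
have h2 : 0 <= s * (48 * K * beta / (m * (p * (1 - p)))).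
  by rewrite mulr_ge0//; apply: divr_ge0; [rewrite !mulr_ge0// ltW|exact: ltW].
have h3 : 0 <= s * (2 * K) by rewrite !mulr_ge0.
move=> h; split; [lra| |lra].
have : s * (48 * K * beta / (m * (p * (1 - p)))) <= 1 by lra.
rewrite [s * _]mulrA ler_pdivrMr// mul1r; lra.
Qed.

Let L := second_moment p c K.
Let Q := fourth_moment p a e.
Let mL : measurable_fun setT L. Proof. exact: measurable_second_moment. Qed.
Let mQ : measurable_fun setT Q. Proof. exact: measurable_fourth_moment. Qed.

Let inv_gt0 (X Y : R) : 0 < X -> 0 < Y -> 0 < inv_total (X, Y).
Proof. by move=> X0 Y0; rewrite invr_gt0 addr_gt0. Qed.

Let L_lower X Y : 0 < X -> 0 < Y -> inv_total (X, Y) <= sbar ->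
  c0 * ((proportion (X, Y) - p) ^+ 2 + inv_total (X, Y)) <= L (X, Y).
Proof.
move=> X0 Y0 hs; have [_ _ h] := sbar_small (ltW (inv_gt0 X0 Y0)) hs.
rewrite /L /second_moment; set D2 := _ ^+ 2; set s := inv_total _ in h *.
have s0 : 0 <= s by exact: ltW (inv_gt0 X0 Y0).
have D20 : 0 <= D2 by exact: sqr_ge0.
have h1 : K * s * D2 <= 2^-1 * D2 by rewrite ler_wpM2r.
have h2 : c0 * D2 <= 2^-1 * D2 by rewrite ler_wpM2r// ge_min lexx.
have h3 : c0 * s <= c * s by rewrite ler_wpM2r// ge_min lexx orbT.
lra.
Qed.

Let L_ge0 X Y : 0 < X -> 0 < Y -> inv_total (X, Y) <= sbar -> 0 <= L (X, Y).
Proof.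
move=> X0 Y0 hs; apply: le_trans (L_lower X0 Y0 hs).
by rewrite mulr_ge0 ?addr_ge0 ?sqr_ge0 ?(ltW c00) ?(ltW (inv_gt0 X0 Y0)).
Qed.

Let Q_upper X Y : 0 < X -> 0 < Y ->
  Q (X, Y) <= C * ((proportion (X, Y) - p) ^+ 2 + inv_total (X, Y)) ^+ 2.
Proof.
move=> X0 Y0; rewrite /Q /fourth_moment /C; set D := _ - p; set s := inv_total _.
have s0 : 0 <= s by exact: ltW (inv_gt0 X0 Y0).
have h1 : 0 <= D ^+ 2 * s by rewrite mulr_ge0// sqr_ge0.
have h2 : 0 <= s ^+ 2 by exact: sqr_ge0.
have h3 : 0 <= D ^+ 2 ^+ 2 by exact: sqr_ge0.
have := mulr_ge0 a0 h1; have := mulr_ge0 a0 h2; have := mulr_ge0 a0 h3.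
have := mulr_ge0 e0 h1; have := mulr_ge0 e0 h2; have := mulr_ge0 e0 h3.
lra.
Qed.

Let Q_ge0 X Y : 0 < X -> 0 < Y -> 0 <= Q (X, Y).
Proof.
move=> X0 Y0; have s0 : 0 <= inv_total (X, Y) by exact: ltW (inv_gt0 X0 Y0).
rewrite /Q /fourth_moment; apply: addr_ge0; last by rewrite mulr_ge0 ?sqr_ge0.
apply: addr_ge0; last by rewrite mulr_ge0// mulr_ge0// sqr_ge0.
by rewrite (_ : 4%N = (2 * 2)%N)// exprM sqr_ge0.
Qed.

Let neqp w : R := if Zinf w == p then 0 else 1.

Let eta := c0 ^+ 2 / C.

Let eta0 : 0 < eta. Proof. by rewrite divr_gt0// exprn_gt0. Qed.

Let mneqp : measurable_fun setT neqp.
Proof.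
by apply: measurable_fun_ifT => //; exact: measurable_fun_eqr.
Qed.

Let neqp_ge0 w : 0 <= neqp w. Proof. by rewrite /neqp; case: ifP. Qed.
Let neqp_le1 w : neqp w <= 1. Proof. by rewrite /neqp; case: ifP. Qed.

Section weight.
Variable delta : R.
Hypothesis delta0 : 0 < delta.

Let g (b : R * R) := tent delta (proportion b - p) * tent sbar (inv_total b).
(* The norm only matters off the reachable states, where the sum may be negative. *)
Let wt (b : R * R) := `|(proportion b - p) ^+ 2 + inv_total b|^-1.

Let mg : measurable_fun setT g.
Proof.
apply: measurable_funM.
  apply: (measurableT_comp (measurable_tent delta)).
  by apply: measurable_funB => //; exact: measurable_proportion.
apply: (measurableT_comp (measurable_tent sbar)); exact: measurable_inv_total.
Qed.

Let mwt : measurable_fun setT wt.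
Proof.
apply: measurable_funV; apply: (measurableT_comp (@normr_measurable R setT)).
apply: measurable_funD; last exact: measurable_inv_total.
by apply: measurable_funX; apply: measurable_funB => //; exact: measurable_proportion.
Qed.

Let g0 b : 0 <= g b. Proof. by rewrite mulr_ge0 ?tent_ge0. Qed.
Let g1 b : g b <= 1.
Proof. by rewrite mulr_ile1 ?tent_ge0 ?tent_le1. Qed.

Let g_support b : 0 < b.1 -> 0 < b.2 -> g b != 0 -> inv_total b <= sbar.
Proof.
move=> b1 b2; rewrite mulf_eq0 negb_or => /andP[_ /(tent_neq0 sbar0) h].
exact: le_trans (ler_norm _) (ltW h).
Qed.

Let wt_bound X Y : 0 < X -> 0 < Y -> 0 <= wt (X, Y) <= X + Y.
Proof.
move=> X0 Y0; have s0 := inv_gt0 X0 Y0.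
have Ds : 0 < (proportion (X, Y) - p) ^+ 2 + inv_total (X, Y).
  by rewrite ltr_wpDl// sqr_ge0.
rewrite /wt gtr0_norm// invr_ge0 (ltW Ds)/= -[leRHS]invrK lef_pV2 ?posrE//.
by rewrite lerDr sqr_ge0.
Qed.

Let total_bound n := x + y + beta *+ n.

Let total_bound0 n : 0 <= total_bound n.
Proof. by rewrite !addr_ge0 ?mulrn_wge0 ?ltW. Qed.

Let wt_state n w : 0 <= wt (state n w) <= total_bound n.
Proof.
have [X0 Y0] := rru_gt0 U VW hmu hnu hx hy n w.
rewrite (surjective_pairing (state n w)).
have /andP[-> h]/= := wt_bound X0 Y0; apply: (le_trans h).
exact: rru_total_le.
Qed.

(** [L] is at least [c0 u] and [Q] at most [C u^2]; dividing by [u] and by [u^2] turns both into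
    multiples of [g], with constants independent of the past. *)
Let h1 b := g b * wt b.
Let h2 b := g b * wt b ^+ 2.

Let mh1 : measurable_fun setT h1. Proof. exact: measurable_funM. Qed.
Let mh2 : measurable_fun setT h2.
Proof. by apply: measurable_funM => //; exact: measurable_funX. Qed.
Let h1_ge0 b : 0 <= h1 b. Proof. by rewrite mulr_ge0// invr_ge0. Qed.
Let h2_ge0 b : 0 <= h2 b. Proof. by rewrite mulr_ge0// sqr_ge0. Qed.

Let h1_bound n w : `|h1 (state n w)| <= total_bound n.
Proof.
rewrite ger0_norm// -[leRHS]mul1r; have /andP[w0 wB] := wt_state n w.
exact: ler_pM.
Qed.

Let h2_bound n w : `|h2 (state n w)| <= total_bound n ^+ 2.
Proof.
rewrite ger0_norm// -[leRHS]mul1r; have /andP[w0 wB] := wt_state n w.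
by apply: ler_pM => //; [exact: sqr_ge0|rewrite lerXn2r ?nnegrE].
Qed.

Let h1_support b : 0 < b.1 -> 0 < b.2 -> h1 b != 0 -> inv_total b <= sbar.
Proof. by move=> b1 b2; rewrite mulf_eq0 negb_or => /andP[/g_support-> //]. Qed.

Let h2_support b : 0 < b.1 -> 0 < b.2 -> h2 b != 0 -> inv_total b <= sbar.
Proof. by move=> b1 b2; rewrite mulf_eq0 negb_or => /andP[/g_support-> //]. Qed.

Let p01' : 0 <= p <= 1. Proof. by case/andP: p01 => *; rewrite !ltW. Qed.

Let second_moment_ge n k : (n <= k)%N ->
  (\int[P]_w (h1 (state n w) * L (state n w))%:E <=
   \int[P]_w (h1 (state n w) * L (state k w))%:E)%E.
Proof.
move=> /subnKC <-; elim: (k - n)%N => [|j IHj]; first by rewrite addn0.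
apply: (le_trans IHj); rewrite addnS.
apply: (weighted_integral_ge hdriving hbeta hmu hnu hmean_mu hmean_nu hx hy
  mh1 h1_ge0 mL mL h1_support L_ge0 L_ge0 (leq_addr j n)) => X Y X0 Y0 hs.
have [b1 b2 _] := sbar_small (ltW (inv_gt0 X0 Y0)) hs.
exact: second_moment_drift.
Qed.

Let fourth_moment_le n k : (n <= k)%N ->
  (\int[P]_w (h2 (state n w) * Q (state k w))%:E <=
   \int[P]_w (h2 (state n w) * Q (state n w))%:E)%E.
Proof.
move=> /subnKC <-; elim: (k - n)%N => [|j IHj]; first by rewrite addn0.
apply: le_trans IHj; rewrite addnS.
apply: (weighted_integral_le hdriving hbeta hmu hnu hmean_mu hmean_nu hx hy
  mh2 h2_ge0 mQ mQ h2_support _ _ (leq_addr j n)) => X Y X0 Y0 hs.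
- exact: Q_ge0.
- exact: Q_ge0.
have [b1 _ _] := sbar_small (ltW (inv_gt0 X0 Y0)) hs.
exact: fourth_moment_drift.
Qed.

Let D_bound X Y : 0 < X -> 0 < Y -> `|proportion (X, Y) - p| <= 1.
Proof.
move=> X0 Y0; have z0 := proportion_ge0 (b := (X, Y)) X0 Y0.
have z1 := proportion_le1 (b := (X, Y)) X0 Y0.
by case/andP: p01' => *; rewrite ler_norml; apply/andP; split; lra.
Qed.

Let cvg_expr_diff j (u : nat -> R) (l q : R) : u k @[k --> \oo] --> l ->
  (u k - q) ^+ j @[k --> \oo] --> (l - q) ^+ j.
Proof.
move=> ul; have h : u k - q @[k --> \oo] --> l - q by apply: cvgB => //; exact: cvg_cst.
exact: (cvg_comp _ (fun z : R => z ^+ j) h (@exprn_continuous R j _)).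
Qed.

Let second_moment_cvg n :
  (\int[P]_w (h1 (state n w) * L (state k w))%:E)%E @[k --> \oo] -->
  (\int[P]_w (h1 (state n w) * (Zinf w - p) ^+ 2)%:E)%E.
Proof.
apply: (@weighted_integral_cvg h1 L (fun z => (z - p) ^+ 2) n (total_bound n)
  (1 + c * (x + y)^-1 + K * (x + y)^-1)) => //.
- by apply: measurable_funX; exact: measurable_funB.
- move=> X Y X0 Y0 hs; have s0 := ltW (inv_gt0 X0 Y0).
  rewrite /L /second_moment; set D := _ - p; set s := inv_total _ in hs s0 *.
  have D2 : D ^+ 2 <= 1 by rewrite -real_normK ?num_real// exprn_ile1// D_bound.
  have t1 : `|D ^+ 2| <= 1 by rewrite ger0_norm ?sqr_ge0.
  have t2 : `|c * s| <= c * (x + y)^-1.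
    rewrite ger0_norm; last exact: mulr_ge0 (ltW c_gt0) s0.
    by rewrite ler_wpM2l ?(ltW c_gt0).
  have t3 : `|K * D ^+ 2 * s| <= K * (x + y)^-1.
    rewrite -mulrA ger0_norm; last first.
      by apply: mulr_ge0 => //; apply: mulr_ge0 => //; exact: sqr_ge0.
    by rewrite ler_wpM2l// -[leRHS]mul1r ler_pM ?sqr_ge0.
  apply: (le_trans (ler_normB _ _)); apply: lerD => //.
  by apply: (le_trans (ler_normD _ _)); apply: lerD.
- move=> w hz hs.
  have hD : (proportion (state k w) - p) ^+ 2 @[k --> \oo] --> (Zinf w - p) ^+ 2.
    exact: cvg_expr_diff.
  have -> : (Zinf w - p) ^+ 2 = (Zinf w - p) ^+ 2 + c * 0 - K * (Zinf w - p) ^+ 2 * 0 by ring.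
  apply: cvgB.
    by apply: cvgD => //; apply: cvgM => //; exact: cvg_cst.
  by apply: cvgM => //; apply: cvgM => //; exact: cvg_cst.
Qed.

Let fourth_moment_cvg n :
  (\int[P]_w (h2 (state n w) * Q (state k w))%:E)%E @[k --> \oo] -->
  (\int[P]_w (h2 (state n w) * (Zinf w - p) ^+ 4)%:E)%E.
Proof.
apply: (@weighted_integral_cvg h2 Q (fun z => (z - p) ^+ 4) n (total_bound n ^+ 2)
  (1 + a * (x + y)^-1 + e * (x + y)^-1 ^+ 2)) => //.
- by apply: measurable_funX; exact: measurable_funB.
- exact: sqr_ge0.
- move=> X Y X0 Y0 hs; have s0 := ltW (inv_gt0 X0 Y0).
  rewrite ger0_norm ?Q_ge0//.
  rewrite /Q /fourth_moment; set D := _ - p; set s := inv_total _ in hs s0 *.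
  have D1 : `|D| <= 1 by exact: D_bound.
  have D2 : D ^+ 2 <= 1 by rewrite -real_normK ?num_real// exprn_ile1.
  have D4 : D ^+ 4 <= 1.
    by rewrite (_ : 4%N = (2 * 2)%N)// exprM exprn_ile1// sqr_ge0.
  apply: lerD; first apply: lerD => //.
  + rewrite -mulrA ler_wpM2l// -[leRHS]mul1r ler_pM ?sqr_ge0//.
  + by rewrite ler_wpM2l// lerXn2r// nnegrE invr_ge0 addr_ge0 ?ltW.
- move=> w hz hs.
  have hD j : (proportion (state k w) - p) ^+ j @[k --> \oo] --> (Zinf w - p) ^+ j.
    exact: cvg_expr_diff.
  have -> : (Zinf w - p) ^+ 4 = (Zinf w - p) ^+ 4 + a * (Zinf w - p) ^+ 2 * 0 + e * 0 ^+ 2.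
    by ring.
  apply: cvgD.
    by apply: cvgD => //; apply: cvgM => //; apply: cvgM => //; exact: cvg_cst.
  apply: cvgM; first exact: cvg_cst.
  exact: (cvg_comp _ (fun z : R => z ^+ 2) hs (@exprn_continuous R 2 _)).
Qed.

Let mgs n : measurable_fun setT (fun w => g (state n w)).
Proof. exact: (measurableT_comp mg). Qed.

Let c0_le n : (c0%:E * \int[P]_w (g (state n w))%:E <=
  \int[P]_w (h1 (state n w) * (Zinf w - p) ^+ 2)%:E)%E.
Proof.
apply: (cvge_to_ge (@second_moment_cvg n)).
exists n => // k /= nk; apply: le_trans (second_moment_ge nk).
rewrite -ge0_integralZl ?lee_fin ?(ltW c00)//; last 2 first.
- exact/measurable_EFinP.
- by move=> w _; rewrite lee_fin.
apply: ge0_le_integral => //.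
- by move=> w _; rewrite -EFinM lee_fin mulr_ge0// ltW.
- by apply/measurable_EFinP; apply: measurable_funM.
- apply/measurable_EFinP; apply: measurable_funM; first exact: (measurableT_comp mh1).
  exact: (measurableT_comp mL).
- move=> w _; rewrite -EFinM lee_fin /h1.
  have [->|gn0] := eqVneq (g (state n w)) 0; first by rewrite mulr0 !mul0r.
  have [X0 Y0] := rru_gt0 U VW hmu hnu hx hy n w.
  have := g_support X0 Y0 gn0; move: gn0.
  rewrite (surjective_pairing (state n w)) => gn0 hs.
  have hL := L_lower X0 Y0 hs.
  rewrite -mulrA mulrC ler_wpM2l//.
  have Ds : 0 < (proportion ((state n w).1, (state n w).2) - p) ^+ 2
     + inv_total ((state n w).1, (state n w).2).
    by rewrite ltr_wpDl ?sqr_ge0 ?inv_gt0.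
  by rewrite /wt gtr0_norm// mulrC ler_pdivlMr.
Qed.

Let le_C n : (\int[P]_w (h2 (state n w) * (Zinf w - p) ^+ 4)%:E <=
  C%:E * \int[P]_w (g (state n w))%:E)%E.
Proof.
apply: (cvge_to_le (@fourth_moment_cvg n)).
exists n => // k /= nk; apply: le_trans (fourth_moment_le nk) _.
rewrite -ge0_integralZl ?lee_fin ?(ltW C0)//; last 2 first.
- exact/measurable_EFinP.
- by move=> w _; rewrite lee_fin.
apply: ge0_le_integral => //.
- move=> w _; rewrite lee_fin mulr_ge0//.
  have [X0 Y0] := rru_gt0 U VW hmu hnu hx hy n w.
  by rewrite (surjective_pairing (state n w)) Q_ge0.
- apply/measurable_EFinP; apply: measurable_funM; first exact: (measurableT_comp mh2).
  exact: (measurableT_comp mQ).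
- by apply/measurable_EFinP; apply: measurable_funM.
- move=> w _; rewrite -EFinM lee_fin /h2.
  have [X0 Y0] := rru_gt0 U VW hmu hnu hx hy n w.
  have hQ := Q_upper X0 Y0.
  rewrite (surjective_pairing (state n w)) -mulrA mulrC ler_wpM2r//.
  have Ds : 0 < (proportion ((state n w).1, (state n w).2) - p) ^+ 2
     + inv_total ((state n w).1, (state n w).2).
    by rewrite ltr_wpDl ?sqr_ge0 ?inv_gt0.
  by rewrite /wt gtr0_norm// exprVn mulrC ler_pdivrMr// exprn_gt0.
Qed.

(** With [q = wt (state n) (Zinf - p)^2], the pointwise bound is [1 >= 4 eps q - 4 eps^2 q^2], a
    completed square. At [Zinf = p] the right side is 0, so the left side may be replaced by [neqp];
    then [c0_le] and [le_C] apply. *)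
Let eta_le n : (eta%:E * \int[P]_w (g (state n w))%:E <=
  \int[P]_w (g (state n w) * neqp w)%:E)%E.
Proof.
(* The maximizer of [4 eps c0 - 4 eps^2 C], whose maximum is [c0^2 / C = eta]. *)
set eps := c0 / (2 * C).
have eps0 : 0 < eps by rewrite divr_gt0 ?mulr_gt0.
have le4 : ((4 * eps)%:E * \int[P]_w (h1 (state n w) * (Zinf w - p) ^+ 2)%:E <=
  \int[P]_w (g (state n w) * neqp w)%:E +
  (4 * eps ^+ 2)%:E * \int[P]_w (h2 (state n w) * (Zinf w - p) ^+ 4)%:E)%E.
  have m2 : measurable_fun setT (fun w => h1 (state n w) * (Zinf w - p) ^+ 2).
    apply: measurable_funM; first exact: (measurableT_comp mh1).
    by apply: measurable_funX; exact: measurable_funB.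
  have m4 : measurable_fun setT (fun w => h2 (state n w) * (Zinf w - p) ^+ 4).
    apply: measurable_funM; first exact: (measurableT_comp mh2).
    by apply: measurable_funX; exact: measurable_funB.
  have p4 z : 0 <= (z : R) ^+ 4 by rewrite (_ : 4%N = (2 * 2)%N)// exprM sqr_ge0.
  have mJ : measurable_fun setT (fun w => g (state n w) * neqp w).
    exact: measurable_funM.
  rewrite -!ge0_integralZl//; first last.
  - by rewrite lee_fin mulr_ge0// ltW.
  - by move=> w _; rewrite lee_fin mulr_ge0// sqr_ge0.
  - exact/measurable_EFinP.
  - by rewrite lee_fin mulr_ge0// sqr_ge0.
  - by move=> w _; rewrite lee_fin mulr_ge0.
  - exact/measurable_EFinP.
  rewrite -ge0_integralD//; first last.
  - by apply/measurable_EFinP; exact: measurable_funM.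
  - move=> w _; rewrite -EFinM lee_fin; apply: mulr_ge0; last exact: mulr_ge0.
    by rewrite mulr_ge0// sqr_ge0.
  - exact/measurable_EFinP.
  - by move=> w _; rewrite lee_fin mulr_ge0.
  apply: ge0_le_integral => //.
  - move=> w _; rewrite -EFinM lee_fin; apply: mulr_ge0.
      by rewrite mulr_ge0// ltW.
    by rewrite mulr_ge0// sqr_ge0.
  - by apply/measurable_EFinP; exact: measurable_funM.
  - apply: emeasurable_funD; apply/measurable_EFinP; first by [].
    exact: measurable_funM.
  move=> w _; rewrite -!EFinM -EFinD lee_fin /h1 /h2 /neqp.
  have [->|zp] := eqVneq (Zinf w) p.
    by rewrite subrr !expr0n/= !mulr0 addr0.
  rewrite -subr_ge0.
  have -> : g (state n w) * 1 + 4 * eps ^+ 2 * (g (state n w) * wt (state n w) ^+ 2 * (Zinf w - p) ^+ 4)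
      - 4 * eps * (g (state n w) * wt (state n w) * (Zinf w - p) ^+ 2)
    = g (state n w) * (1 - 2 * eps * wt (state n w) * (Zinf w - p) ^+ 2) ^+ 2 by ring.
  by rewrite mulr_ge0// sqr_ge0.
have Efin (f : T -> R) : measurable_fun setT f -> (forall w, 0 <= f w <= 1) ->
    exists r, (\int[P]_w (f w)%:E = r%:E)%E.
  move=> mf f01; exists (fine (\int[P]_w (f w)%:E)%E); rewrite fineK//.
  rewrite ge0_fin_numE; last by apply: integral_ge0 => w _; rewrite lee_fin; case/andP: (f01 w).
  apply: (@le_lt_trans _ _ (\int[P]_w 1%:E)%E); last first.
    by rewrite integral_cst//= probability_setT mule1 ltry.
  apply: ge0_le_integral => //.
  - by move=> w _; rewrite lee_fin; case/andP: (f01 w).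
  - exact/measurable_EFinP.
  - by move=> w _; rewrite lee_fin; case/andP: (f01 w).
have [|G hG] := Efin _ (mgs n); first by move=> w; rewrite g0 g1.
have [|J hJ] := Efin _ (measurable_funM (mgs n) mneqp).
  by move=> w /=; rewrite mulr_ge0//= mulr_ile1.
have := le_C n; have := c0_le n; move: le4.
rewrite hG [X in (_ <= X + _)%E]hJ [X in _ -> _ -> _ -> (_ <= X)%E]hJ.
set I1 := (\int[P]_w _)%E; set I2 := (\int[P]_w _)%E => l1 l2 l3.
have e40 : (0 <= (4 * eps)%:E)%E by rewrite lee_fin mulr_ge0// ltW.
have e42 : (0 <= (4 * eps ^+ 2)%:E)%E by rewrite lee_fin mulr_ge0// sqr_ge0.
have := le_trans (lee_wpmul2l e40 l2) (le_trans l1 (leeD2l J%:E (lee_wpmul2l e42 l3))).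
rewrite -!EFinM -EFinD !lee_fin => h.
have -> : eta * G = 4 * eps * (c0 * G) - 4 * eps ^+ 2 * (C * G).
  by rewrite /eta /eps; field; rewrite gt_eqF.
by rewrite lerBlDr.
Qed.

(** As [n] grows, the cutoff in [inv_total] tends to [tent sbar 0 = 1] and disappears, leaving a
    statement about [Zinf] alone. That [eta] does not depend on [delta] is what makes it useful. *)
Lemma non_return : (eta%:E * \int[P]_w (tent delta (Zinf w - p))%:E <=
  \int[P]_w (tent delta (Zinf w - p) * neqp w)%:E)%E.
Proof.
have mt : measurable_fun setT (fun w => tent delta (Zinf w - p)).
  by apply: (measurableT_comp (measurable_tent delta)); exact: measurable_funB.
have gcvg : {ae P, forall w, g (state n w) @[n --> \oo] --> tent delta (Zinf w - p)}.
  have h0 := ae_inv_total_cvg0 hdriving hbeta hmu hnu hm hmean_mu hmean_nu hx hy.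
  apply: filterS2 (cvg_tent delta p) h0 => w h1' h2'.
  rewrite -[X in _ --> X]mulr1 -(tent0 sbar); apply: cvgM => //.
  by apply: continuous_cvg => //; exact: continuous_tent.
have c1 : (\int[P]_w (eta * g (state n w))%:E)%E @[n --> \oo] -->
    (\int[P]_w (eta * tent delta (Zinf w - p))%:E)%E.
  apply: (@bounded_cvg_integral _ _ _ P _ _ eta).
  - by move=> n; exact: measurable_funM.
  - exact: measurable_funM.
  - move=> n w; rewrite ger0_norm; last by apply: mulr_ge0 => //; exact: ltW eta0.
    by rewrite -[leRHS]mulr1 ler_wpM2l ?(ltW eta0).
  - by apply: filterS gcvg => w hw; apply: cvgM => //; exact: cvg_cst.
have c2 : (\int[P]_w (g (state n w) * neqp w)%:E)%E @[n --> \oo] -->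
    (\int[P]_w (tent delta (Zinf w - p) * neqp w)%:E)%E.
  apply: (@bounded_cvg_integral _ _ _ P _ _ 1).
  - by move=> n; exact: measurable_funM.
  - exact: measurable_funM.
  - move=> n w; rewrite ger0_norm; last exact: mulr_ge0.
    by rewrite mulr_ile1.
  - by apply: filterS gcvg => w hw; apply: cvgM => //; exact: cvg_cst.
rewrite -ge0_integralZl ?lee_fin ?(ltW eta0)//; last 2 first.
- exact/measurable_EFinP.
- by move=> w _; rewrite lee_fin tent_ge0.
under eq_integral do rewrite -EFinM.
apply: (lee_cvg_to c1 c2); apply: nearW => n.
under eq_integral do rewrite EFinM.
rewrite ge0_integralZl ?lee_fin ?(ltW eta0)//; last 2 first.
- exact/measurable_EFinP.
- by move=> w _; rewrite lee_fin.
Qed.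

End weight.

(** Shrinking [delta] to 0 sends the right side of [non_return] to 0, since the tents then
    concentrate at [p], where [neqp] vanishes; the left side never falls below
    [eta * P (Zinf = p)]. *)
Lemma no_point_mass_interior : P [set w | Zinf w = p] = 0%E.
Proof.
have mA : measurable [set w | Zinf w = p].
  by have := mZ measurableT (measurable_set1 p); rewrite setTI.
have cv : (\int[P]_w (tent n.+1%:R^-1 (Zinf w - p) * neqp w)%:E)%E @[n --> \oo] -->
    (\int[P]_w (cst 0 w)%:E)%E.
  apply: (@bounded_cvg_integral _ _ _ P _ _ 1) => //.
  - move=> n; apply: measurable_funM => //.
    by apply: (measurableT_comp (measurable_tent _)); exact: measurable_funB.
  - move=> n w; rewrite ger0_norm; last by rewrite mulr_ge0 ?tent_ge0.
    by rewrite mulr_ile1 ?tent_ge0 ?tent_le1.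
  - apply: aeW => w; rewrite /neqp; have [->|zp] := eqVneq (Zinf w) p.
      by under eq_fun do rewrite mulr0; exact: cvg_cst.
    have d0 : 0 < `|Zinf w - p| by rewrite normr_gt0 subr_eq0.
    apply: cvg_near_cst; exists (Num.bound `|Zinf w - p|^-1) => // n /= hn.
    apply/eqP; rewrite mulr1 tent_eq0//.
    rewrite -[leRHS]invrK lef_pV2 ?posrE ?invr_gt0//.
    apply: ltW; apply: lt_le_trans (archi_boundP _) _; first by rewrite invr_ge0 ltW.
    by rewrite ler_nat (leq_trans hn).
have le0 : (eta%:E * P [set w | Zinf w = p] <= 0)%E.
  have -> : 0%E = (\int[P]_w (cst 0 w)%:E)%E by rewrite integral0.
  apply: (cvge_to_ge cv); apply: nearW => n.
  apply: le_trans (non_return _); last by rewrite invr_gt0.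
  by apply: lee_wpmul2l; [rewrite lee_fin ltW|exact: probability_le_tent].
have Pfin : P [set w | Zinf w = p] \is a fin_num by rewrite fin_num_measure.
move: le0; rewrite -[P _]fineK// -EFinM lee_fin pmulr_rle0// => le0.
by congr EFin; apply/eqP; rewrite eq_le le0 fine_ge0.
Qed.

End interior.
End no_point_mass.

Unset Implicit Arguments.

(** Both initial contents are taken positive. With [x = 0 < y] the first color is almost surely
    never drawn and the limit is almost surely 0, which is a point mass; the case [y = 0 < x] gives
    the limit 1. *)
Theorem theorem3p2 (R : realType) (d : measure_display) (T : measurableType d)
  (P : probability T R)
  (U : nat -> {RV P >-> R}) (VW : nat -> {RV P >-> (R * R)%type})
  (hdriving : rru_driving U VW)
  (beta : R) (hbeta : 0 < beta)
  (mu nu : probability (measurableTypeR R) R)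
  (hmu : mu `[0, beta]%classic = 1%E) (hnu : nu `[0, beta]%classic = 1%E)
  (m : R) (hm : 0 < m) (hmean_mu : mean mu = m%:E) (hmean_nu : mean nu = m%:E)
  (x y : R) (hx : 0 < x) (hy : 0 < y)
  (Zinf : {RV P >-> R})
  (hZinf : {ae P, forall w,
    rru_proportion U VW mu nu x y n w @[n --> \oo] --> Zinf w}) :
  forall p : R, 0 <= p <= 1 -> P [set w | Zinf w = p] = 0%E.
Proof.
move=> p /andP[p0 p1].
have [->|pn0] := eqVneq p 0.
  exact: (no_point_mass0 hdriving hbeta hmu hnu hmean_mu hmean_nu hx hy hZinf).
have [->|pn1] := eqVneq p 1.
  exact: (no_point_mass1 hdriving hbeta hmu hnu hmean_mu hmean_nu hx hy hZinf).
have p01 : 0 < p < 1 by rewrite !lt_neqAle p0 p1 eq_sym pn0 pn1.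
exact: (no_point_mass_interior hdriving hbeta hmu hnu hm hmean_mu hmean_nu hx hy
  hZinf p01 erefl erefl erefl erefl erefl).
Qed.
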